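(* Let $u$, $L$, $\mathcal A^\star$, $K^\star$, $\mathcal V_{\mathcal A^\star}$, $\widehat u_{K^\star}$, $\|\cdot\|_{\mathcal R}$ and $\mathcal E_k$ be as defined in the context, and let $\eta_{\rm feat},\eta_{\rm LS}\in(0,1)$ with $\eta_{\rm feat}+\eta_{\rm LS}<1$. Assume the following. (A1) (selected ANOVA approximation) With $u_{\mathcal A^\star}=\sum_{S\in\mathcal A^\star}u_S$ and constants $\tau_{\rm sol},\tau_{\rm res}\ge 0$, $$\|u-u_{\mathcal A^\star}\|_{L^2(\Omega)}\le \tau_{\rm sol}\|u\|_{L^2(\Omega)},\qquad \|u-u_{\mathcal A^\star}\|_{\mathcal R}\le \tau_{\rm res}\|u\|_{L^2(\Omega)}.$$ For each nonempty $S\in\mathcal A^\star$ with $|S|=k$ and each failure budget $\eta\in(0,1)$, with probability at least $1-\eta$ over the random features, $$\inf_{v_S\in\mathcal V_{S,M_k}}\|u_S-v_S\|_{H^2(\Omega_S)}\le e^{\rm rf}_{S,M_k}(R_{\rm rf},\eta).$$ The comparison function is $u^\dagger=\sum_{S\in\mathcal A^\star}v_S\in\mathcal V_{\mathcal A^\star}$, where $v_\emptyset=u_\emptyset$ and $v_S\in\mathcal V_{S,M_{|S|}}$ realizes the preceding bound for nonempty $S$; its concatenated coefficient vector $\bm c^\dagger$ satisfies $\|\bm c^\dagger\|_2\le B_{\rm coef}$. (A2) (elliptic and block stability) There are constants $C_{\rm ell}^{\rm bd},C_{\rm op},\Gamma_{K^\star}>0$ such that $$\|e\|_{L^2(\Omega)}\le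 C_{\rm ell}^{\rm bd}\|e\|_{\mathcal R}\qquad\text{for all } e\in H^1(\Omega)\text{ with }\operatorname{Tr}e\in\mathcal Y_\partial,$$ and the selected component errors $z_S\in H^2(\Omega_S)$, $S\in\mathcal A^\star$, identified with $x\mapsto z_S(x_S)$ on $\Omega$, satisfy $$\Bigl\|\sum_{S\in\mathcal A^\star}z_S\Bigr\|_{\mathcal R}\le C_{\rm op}\Gamma_{K^\star}^{1/2}\Bigl(\sum_{S\in\mathcal A^\star}\|z_S\|_{H^2(\Omega_S)}^2\Bigr)^{1/2}.$$ (A3) (sampled least-squares stability) There are constants $C_{\rm ls},C_{\rm samp},C_{\rm reg}>0$ such that, with probability at least $1-\eta_{\rm LS}$ over the interior and boundary samples, $$\|\widehat u_{K^\star}-u^\dagger\|_{\mathcal R}\le C_{\rm ls}\bigl[\|u^\dagger-u\|_{\mathcal R}+C_{\rm samp}\chi_N+C_{\rm reg}\lambda_{\rm reg}^{1/2}B_{\rm coef}\bigr],$$ where $\chi_N=(N_{\rm int}^{-1/2}+N_{\rm bc}^{-1/2})\sqrt{\log(1/\eta_{\rm LS})}$. Then, with probability at least $1-\eta_{\rm feat}-\eta_{\rm LS}$ over the random features and collocation samples, $$\begin{aligned}\|u-\widehat u_{K^\star}\|_{L^2(\Omega)}&\le\bigl(\tau_{\rm sol}+C_{\rm ell}^{\rm bd}C_{\rm ls}\tau_{\rm res}\bigr)\|u\|_{L^2(\Omega)}\\&\quad+C_{\rm ell}^{\rm bd}(1+C_{\rm ls})\Bigl[C_{\rm op}\Gamma_{K^\star}^{1/2}\Bigl(\sum_{k=1}^{K^\star}\mathcal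 E_k(R_{\rm rf},M_k,\eta_{\rm feat})^2\Bigr)^{1/2}+C_{\rm samp}\chi_N+C_{\rm reg}\lambda_{\rm reg}^{1/2}B_{\rm coef}\Bigr].\end{aligned}$$
   Context: Domain and ANOVA. $\Omega=\prod_{i=1}^d\Omega_i\subset\mathbb R^d$ is a bounded product domain (for instance $(0,1)^d$), $\mathcal I_d=\{1,\dots,d\}$, and $\mu=\otimes_i\mu_i$ is a product probability reference measure (normalized Lebesgue measure on cubes). For $S\subseteq\mathcal I_d$, $x_S$ is the coordinate subvector and $\Omega_S=\prod_{i\in S}\Omega_i$. The integral ANOVA decomposition of $u$ is $u=\sum_{S\subseteq\mathcal I_d}u_S(x_S)$ with $u_\emptyset=\int_\Omega u\,d\mu$ and $u_S=\mathbb E_\mu[u\mid x_S]-\sum_{T\subsetneq S}u_T$ for $S\neq\emptyset$. Selected family and trial space. $\mathcal A^\star$ is a fixed family of subsets of $\mathcal I_d$ containing $\emptyset$ and all singletons; $K^\star=\max_{S\in\mathcal A^\star}|S|$; $n_k^{\rm blk}=|\{S\in\mathcal A^\star:|S|=k\}|$. For nonempty $S$ with $|S|=k$, $\mathcal V_{S,M_k}$ is the span of $M_k$ random features $\phi_{S,m}(x)=\sigma(\omega_{S,m}\cdot x_S+b_{S,m})$, $1\le m\le M_k$, with fixed activation $\sigma\in C^2(\mathbb R)$ and randomly sampled (then frozen) $\omega_{S,m}\in\mathbb R^k$, $b_{S,m}\in\mathbb R$; $R_{\rm rf}>0$ is the frequency radius of the sampling law. For $S=\emptyset$, $M_0=1$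 and the single feature is the constant $1$. $\mathcal V_{\mathcal A^\star}=\sum_{S\in\mathcal A^\star}\mathcal V_{S,M_{|S|}}$. PDE. $Lv=-\sum_{i,j}a_{ij}(x)\partial_{ij}v+b(x)\cdot\nabla v+\kappa(x)v$ is uniformly elliptic with sufficiently regular coefficients, and $u$ solves $Lu=f$ in $\Omega$ with Dirichlet data $g$ (nonhomogeneous data are handled by a fixed boundary lift). $\operatorname{Tr}$ is the trace operator, $\mathcal Y_\partial$ a trace space on $\partial\Omega$ (e.g. $H^{1/2}(\partial\Omega)$), $\omega_{\rm th}>0$ is fixed, and $$\|v\|_{\mathcal R}:=\|Lv\|_{H^{-1}(\Omega)}+\omega_{\rm th}\|\operatorname{Tr}v\|_{\mathcal Y_\partial}.$$ Fitted function. $\widehat u_{K^\star}\in\mathcal V_{\mathcal A^\star}$ is the Tikhonov-regularized collocation least-squares solution: its coefficient vector minimizes $$\frac1{N_{\rm int}}\sum_{n=1}^{N_{\rm int}}|Lv_{\bm c}(x^{\rm int}_n)-f(x^{\rm int}_n)|^2+\frac{\omega_{\rm bc}^2}{N_{\rm bc}}\sum_{n=1}^{N_{\rm bc}}|v_{\bm c}(x^{\rm bc}_n)-g(x^{\rm bc}_n)|^2+\lambda_{\rm reg}\|\bm c\|_2^2,$$ where $v_{\bm c}=\sum_{S\in\mathcal A^\star}\sum_m c_{S,m}\phi_{S,m}$, with random interior points $x^{\rm int}_n\in\Omega$, boundary points $x_n^{\rm bc}\in\partial\Omega$, $\omega_{\rm bc}>0$, $\lambda_{\rm reg}\ge0$.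 Aggregate feature error. $e^{\rm rf}_{S,M_k}(R_{\rm rf},\eta)\ge0$ are given numbers, and for $n_k^{\rm blk}>0$ $$\mathcal E_k(R_{\rm rf},M_k,\eta)^2:=\sum_{S\in\mathcal A^\star,\,|S|=k}e^{\rm rf}_{S,M_k}\Bigl(R_{\rm rf},\frac{\eta}{K^\star n_k^{\rm blk}}\Bigr)^2,$$ with $\mathcal E_k=0$ if $n_k^{\rm blk}=0$. *)

(* Defs.v *)
From HB Require Import structures.
From mathcomp Require Import all_boot all_order all_algebra.
From mathcomp Require Import all_classical all_reals all_analysis.
Set Implicit Arguments.
Unset Strict Implicit.
Unset Printing Implicit Defensive.
Import Order.TTheory GRing.Theory Num.Theory.
Import numFieldNormedType.Exports.
Local Open Scope classical_set_scope.
Local Open Scope ring_scope.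

Definition rV_display : measure_display -> measure_display.
Proof. exact. Qed.

Definition rV_coord (R : realType) (n : nat) (i : 'I_n) (x : 'rV[R]_n) :
  measurableTypeR R := x ord0 i.

Definition rV_measurable (R : realType) (n : nat) : set (set 'rV[R]_n) :=
  g_sigma_preimage (@rV_coord R n).

Lemma rV_measurable0 (R : realType) (n : nat) : @rV_measurable R n set0.
Proof. exact: sigma_algebra0. Qed.

Lemma rV_measurableC (R : realType) (n : nat) (A : set 'rV[R]_n) :
  rV_measurable A -> rV_measurable (~` A).
Proof. exact: sigma_algebraC. Qed.

Lemma rV_measurable_bigcup (R : realType) (n : nat) (F : (set 'rV[R]_n)^nat) :
  (forall i, rV_measurable (F i)) -> rV_measurable (\bigcup_i (F i)).
Proof. exact: sigma_algebra_bigcup. Qed.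

HB.instance Definition _ (R : realType) (n : nat) :=
  @isMeasurable.Build (rV_display default_measure_display) 'rV[R]_n
    (@rV_measurable R n) (@rV_measurable0 R n) (@rV_measurableC R n)
    (@rV_measurable_bigcup R n).

Lemma measurable_rV_coord (R : realType) (n : nat) (i : 'I_n) :
  measurable_fun setT (@rV_coord R n i).
Proof.
move=> _ B mB; rewrite setTI; apply: sub_sigma_algebra => /=.
rewrite -bigcup_seq/=; exists i => /=; first by rewrite mem_index_enum.
by exists B => //; rewrite setTI.
Qed.

Lemma measurable_to_rV d (T : measurableType d) (R : realType) (n : nat)
    (f : T -> 'rV[R]_n) :
  (forall i, measurable_fun setT (@rV_coord R n i \o f)) ->
  measurable_fun setT f.
Proof.
move=> mf; apply: (@measurability _ _ _ _ _ f
  (\big[setU/set0]_(i < n) preimage_set_system setT (@rV_coord R n i) measurable)).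
  by [].
move=> _ [A + <-]; rewrite -bigcup_seq/= => -[i _ [B mB <-]].
by rewrite !setTI; have := mf i measurableT B mB; rewrite setTI.
Qed.

Definition cons_rV (R : realType) (n : nat) (p : measurableTypeR R * 'rV[R]_n) :
    'rV[R]_n.+1 :=
  \row_i (if unlift ord0 i is Some j then p.2 ord0 j else p.1).

Definition behead_rV (R : realType) (n : nat) (x : 'rV[R]_n.+1) : 'rV[R]_n :=
  \row_j x ord0 (lift ord0 j).

Lemma measurable_cons_rV (R : realType) (n : nat) :
  measurable_fun setT (@cons_rV R n).
Proof.
apply: measurable_to_rV => i.
have -> : @rV_coord R n.+1 i \o @cons_rV R n =
    if unlift ord0 i is Some j then @rV_coord R n j \o snd else fst.
  by apply: funext => p; rewrite /rV_coord /cons_rV /= mxE; case: unlift.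
case: unlift => [j|]; last exact: measurable_fst.
exact: measurableT_comp (measurable_rV_coord j) measurable_snd.
Qed.

HB.instance Definition _ (R : realType) (n : nat) :=
  @isMeasurableFun.Build _ _ _ _ (@cons_rV R n) (@measurable_cons_rV R n).

Section cons_measure.
Context (R : realType) (n : nat).
Variable m1 : {sigma_finite_measure set (measurableTypeR R) -> \bar R}.
Variable m2 : {sigma_finite_measure set 'rV[R]_n -> \bar R}.

Definition cons_measure : set 'rV[R]_n.+1 -> \bar R :=
  pushforward (m1 \x m2)%E (@cons_rV R n).

Let cons_measure0 : cons_measure set0 = 0%E.
Proof. by rewrite /cons_measure /pushforward preimage_set0 measure0. Qed.

Let cons_measure_ge0 A : (0 <= cons_measure A)%E.
Proof. exact: measure_ge0. Qed.

Let preimage_cons A : measurable A -> measurable (@cons_rV R n @^-1` A).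
Proof.
by move=> mA; rewrite -[X in measurable X]setTI; exact: measurable_cons_rV.
Qed.

Let cons_measure_sigma_additive : semi_sigma_additive cons_measure.
Proof.
move=> F mF tF mUF; rewrite /cons_measure /pushforward preimage_bigcup.
apply: measure_semi_sigma_additive.
- by move=> k; exact: preimage_cons.
- apply/trivIsetP => /= i j _ _ ij; rewrite -preimage_setI.
  by move/trivIsetP : tF => /(_ _ _ _ _ ij) ->//; rewrite preimage_set0.
- by rewrite -preimage_bigcup; exact: preimage_cons.
Qed.

HB.instance Definition _ := isMeasure.Build _ _ _ cons_measure
  cons_measure0 cons_measure_ge0 cons_measure_sigma_additive.

Let cons_measure_sigma_finite : sigma_finite setT cons_measure.
Proof.
have /sigma_finiteP[F [TF ndF Foo]] := sigma_finiteT m1.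
have /sigma_finiteP[G [TG ndG Goo]] := sigma_finiteT m2.
pose g (x : 'rV[R]_n.+1) : measurableTypeR R * 'rV[R]_n :=
  (@rV_coord R n.+1 ord0 x, behead_rV x).
have mg : measurable_fun setT g.
  apply: measurable_fun_pair; first exact: measurable_rV_coord.
  apply: measurable_to_rV => i.
  rewrite [X in measurable_fun _ X](_ : _ = @rV_coord R n.+1 (lift ord0 i)).
    exact: measurable_rV_coord.
  by apply: funext => x; rewrite /rV_coord /behead_rV /= mxE.
have consK : cancel (@cons_rV R n) g.
  move=> [t y]; rewrite /g /rV_coord /cons_rV mxE unlift_none /=; congr pair.
  by apply/rowP => j; rewrite !mxE liftK.
exists (fun k => g @^-1` (F k `*` G k)).
  apply/esym; rewrite -subTset => x _.
  have [a _ Fa] : (\bigcup_k F k) (g x).1 by rewrite -TF.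
  have [b _ Gb] : (\bigcup_k G k) (g x).2 by rewrite -TG.
  exists (maxn a b) => //; split.
    by move: Fa; exact/subsetPset/ndF/leq_maxl.
  by move: Gb; exact/subsetPset/ndG/leq_maxr.
move=> k; have [mF Flt] := Foo k; have [mG Glt] := Goo k; split.
  by rewrite -[X in measurable X]setTI; apply: mg => //; exact: measurableX.
rewrite /cons_measure /pushforward -comp_preimage.
rewrite (_ : g \o _ = id) ?preimage_id; last by apply: funext => p; exact: consK.
by rewrite product_measure1E// lte_mul_pinfty// ge0_fin_numE.
Qed.

HB.instance Definition _ := Measure_isSigmaFinite.Build _ _ _ cons_measure
  cons_measure_sigma_finite.

End cons_measure.

Fixpoint prod_measure (R : realType) (n : nat) :
    ('I_n -> {sigma_finite_measure set (measurableTypeR R) -> \bar R}) ->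
    {sigma_finite_measure set 'rV[R]_n -> \bar R} :=
  match n with
  | 0 => fun=> dirac (0 : 'rV[R]_0)
  | n'.+1 => fun m => cons_measure (m ord0) (prod_measure (m \o lift ord0))
  end.

Definition leb (R : realType) (n : nat) :
    {sigma_finite_measure set 'rV[R]_n -> \bar R} :=
  prod_measure (fun=> @lebesgue_measure R).

Definition box (R : realType) (n : nat) (lo hi : 'I_n -> R) : set 'rV[R]_n :=
  [set x | forall i, lo i < x ord0 i < hi i].

Definition partial (R : realType) (n : nat) (i : 'I_n) (f : 'rV[R]_n -> R) :
    'rV[R]_n -> R :=
  fun x => 'D_(delta_mx ord0 i) f x.

Definition bounded_on (R : realType) (n : nat) (D : set 'rV[R]_n)
    (f : 'rV[R]_n -> R) :=
  exists B : R, forall x, D x -> `|f x| <= B.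

Fixpoint Ck (R : realType) (n k : nat) (D : set 'rV[R]_n)
    (f : 'rV[R]_n -> R) : Prop :=
  (forall x, D x -> {for x, continuous f}) /\
  match k with
  | 0 => True
  | k'.+1 => forall i : 'I_n,
      (forall x, D x -> derivable f x (delta_mx ord0 i)) /\
      Ck k' D (partial i f)
  end.

Fixpoint Ckb (R : realType) (n k : nat) (D : set 'rV[R]_n)
    (f : 'rV[R]_n -> R) : Prop :=
  (forall x, D x -> {for x, continuous f}) /\ bounded_on D f /\
  match k with
  | 0 => True
  | k'.+1 => forall i : 'I_n,
      (forall x, D x -> derivable f x (delta_mx ord0 i)) /\
      Ckb k' D (partial i f)
  end.

Definition test_function (R : realType) (n : nat) (Om : set 'rV[R]_n)
    (phi : 'rV[R]_n -> R) : Prop :=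
  (forall k, Ck k setT phi) /\
  exists2 K : set 'rV[R]_n, compact K /\ K `<=` Om &
    forall x, ~ K x -> phi x = 0.

Definition multi_index (n k : nat) := {ffun 'I_n -> 'I_k.+1}.

Definition order_of (n k : nat) (al : multi_index n k) : nat :=
  \sum_i (al i : nat).

Definition mpartial (R : realType) (n k : nat) (al : multi_index n k)
    (f : 'rV[R]_n -> R) : 'rV[R]_n -> R :=
  foldr (fun i g => iter (al i) (partial i) g) f (enum 'I_n).

Definition L2norm (R : realType) (n : nat) (Om : set 'rV[R]_n)
    (v : 'rV[R]_n -> R) : \bar R :=
  'N[leb R n]_2%:E[EFin \o (v \_ Om)].

Definition loc_integrable (R : realType) (n : nat) (Om : set 'rV[R]_n)
    (v : 'rV[R]_n -> R) : Prop :=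
  forall K, compact K -> K `<=` Om -> (leb R n).-integrable K (EFin \o v).

Definition weak_derivative (R : realType) (n k : nat) (Om : set 'rV[R]_n)
    (al : multi_index n k) (v w : 'rV[R]_n -> R) : Prop :=
  [/\ loc_integrable Om v, loc_integrable Om w &
    forall phi, test_function Om phi ->
      (\int[leb R n]_(x in Om) (v x * mpartial al phi x) =
       (-1) ^+ order_of al * \int[leb R n]_(x in Om) (w x * phi x))%R].

Definition weak_derivatives (R : realType) (n k : nat) (Om : set 'rV[R]_n)
    (v : 'rV[R]_n -> R) : set (multi_index n k -> 'rV[R]_n -> R) :=
  [set w | w [ffun=> ord0] = v /\
    forall al, (order_of al <= k)%N ->
      measurable_fun Om (w al) /\ weak_derivative Om al v (w al)].

(* Weak derivatives are unique up to null sets, so for a [v] that has them the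
   infimum is over one value; it is [+oo] for a [v] that has not. *)
Definition Hnorm (R : realType) (n k : nat) (Om : set 'rV[R]_n)
    (v : 'rV[R]_n -> R) : \bar R :=
  ereal_inf [set ((\sum_(al : multi_index n k | (order_of al <= k)%N)
                     (L2norm Om (w al)) ^+ 2) `^ 2^-1)%E
            | w in weak_derivatives Om v].

Definition in_H (R : realType) (n k : nat) (Om : set 'rV[R]_n)
    (v : 'rV[R]_n -> R) : Prop :=
  (Hnorm k Om v < +oo)%E.

(* The norm of a distribution [F] in the dual of [H^1_0(Om)]; [+oo] when [F]
   does not belong to it. *)
Definition Hm1norm (R : realType) (n : nat) (Om : set 'rV[R]_n)
    (F : ('rV[R]_n -> R) -> R) : \bar R :=
  ereal_sup [set (`|F phi|)%:E
            | phi in [set phi | test_function Om phi /\ (Hnorm 1 Om phi <= 1)%E]].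

Definition face (R : realType) (n : nat) (lo hi : 'I_n -> R) (i : 'I_n)
    (e : bool) (x : 'rV[R]_n) : 'rV[R]_n :=
  \row_j (if j == i then (if e then hi i else lo i) else x ord0 j).

Definition bd_measurable (R : realType) (n : nat) (lo hi : 'I_n -> R)
    (g : 'rV[R]_n -> R) : Prop :=
  forall i e, measurable_fun (box lo hi) (g \o face lo hi i e).

(* [g \o face lo hi i e] does not depend on the [i]-th coordinate: integrating
   it over the box counts the face integral [hi i - lo i] times. The edges,
   where faces meet, have surface measure 0. *)
Definition bd_L2norm (R : realType) (n : nat) (lo hi : 'I_n -> R)
    (g : 'rV[R]_n -> R) : \bar R :=
  ((\sum_(i < n) \sum_(e : bool) ((hi i - lo i)^-1)%:E *
      \int[leb R n]_(x in box lo hi) (`|g (face lo hi i e x)| ^+ 2)%:E)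
   `^ 2^-1)%E.

Definition in_bd_L2 (R : realType) (n : nat) (lo hi : 'I_n -> R)
    (g : 'rV[R]_n -> R) : Prop :=
  bd_measurable lo hi g /\ (bd_L2norm lo hi g < +oo)%E.

Definition bd_ae_eq (R : realType) (n : nat) (lo hi : 'I_n -> R)
    (g h : 'rV[R]_n -> R) : Prop :=
  forall i e, {ae leb R n, forall x, box lo hi x ->
    g (face lo hi i e x) = h (face lo hi i e x)}.

(* [g = Tr v], with [Tr] the continuous extension to [H^1] of the restriction
   to the boundary of functions that are [C^1] up to the boundary *)
Definition is_trace (R : realType) (n : nat) (lo hi : 'I_n -> R)
    (v g : 'rV[R]_n -> R) : Prop :=
  [/\ in_H 1 (box lo hi) v, in_bd_L2 lo hi g &
    exists phi : nat -> 'rV[R]_n -> R,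
      [/\ forall m, Ck 1 setT (phi m),
          Hnorm 1 (box lo hi) (v \- phi m) @[m --> \oo] --> 0%E &
          bd_L2norm lo hi (g \- phi m) @[m --> \oo] --> 0%E]].

(* [Y] is the norm of a space of (classes of) square-integrable functions on
   the boundary, extended by [+oo] outside that space. *)
Record trace_space (R : realType) (n : nat) (lo hi : 'I_n -> R)
    (Y : ('rV[R]_n -> R) -> \bar R) : Prop := TraceSpace {
  trace_space_ge0 : forall g, (0 <= Y g)%E ;
  trace_space_L2 : forall g, (Y g < +oo)%E -> in_bd_L2 lo hi g ;
  trace_space_ae : forall g h, in_bd_L2 lo hi g -> in_bd_L2 lo hi h ->
    bd_ae_eq lo hi g h -> Y g = Y h ;
  trace_space_eq0 : forall g, Y g = 0%E -> bd_ae_eq lo hi g (cst 0) ;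
  trace_spaceZ : forall (c : R) g, Y (c \*o g) = (`|c|%:E * Y g)%E ;
  trace_spaceD : forall g h, (Y (g \+ h)%R <= Y g + Y h)%E }.

(* [Y (Tr v)]: two traces of [v] agree almost everywhere, hence have the same
   [Y] norm. It is [+oo] when [v] is not in [H^1] or [Tr v] is not in [Y]. *)
Definition trace_norm (R : realType) (n : nat) (lo hi : 'I_n -> R)
    (Y : ('rV[R]_n -> R) -> \bar R) (v : 'rV[R]_n -> R) : \bar R :=
  ereal_inf [set Y g | g in is_trace lo hi v].

Record operator (R : realType) (d : nat) := Operator {
  op_a : 'I_d -> 'I_d -> 'rV[R]_d -> R ;
  op_b : 'I_d -> 'rV[R]_d -> R ;
  op_c : 'rV[R]_d -> R }.

Definition regular_coefficients (R : realType) (d : nat) (Om : set 'rV[R]_d)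
    (L : operator R d) : Prop :=
  [/\ forall i j, Ckb 2 Om (op_a L i j), forall i, Ckb 1 Om (op_b L i) &
      Ckb 0 Om (op_c L)].

Definition uniformly_elliptic (R : realType) (d : nat) (Om : set 'rV[R]_d)
    (L : operator R d) : Prop :=
  exists2 alpha : R, 0 < alpha & forall x (xi : 'rV[R]_d), Om x ->
    alpha * (\sum_i xi ord0 i ^+ 2) <=
    \sum_i \sum_j op_a L i j x * xi ord0 i * xi ord0 j.

Definition op_apply (R : realType) (d : nat) (L : operator R d)
    (v : 'rV[R]_d -> R) (x : 'rV[R]_d) : R :=
  - (\sum_i \sum_j op_a L i j x * partial i (partial j v) x)
  + \sum_i op_b L i x * partial i v x + op_c L x * v x.

Definition op_adjoint (R : realType) (d : nat) (L : operator R d)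
    (phi : 'rV[R]_d -> R) (x : 'rV[R]_d) : R :=
  - (\sum_i \sum_j partial i (partial j (op_a L i j \* phi)) x)
  - \sum_i partial i (op_b L i \* phi) x + op_c L x * phi x.

(* [v] is at most in [H^1] in general, so the derivatives are moved to the
   test function *)
Definition op_distr (R : realType) (d : nat) (Om : set 'rV[R]_d)
    (L : operator R d) (v phi : 'rV[R]_d -> R) : R :=
  (\int[leb R d]_(x in Om) (v x * op_adjoint L phi x))%R.

Definition dirichlet_solution (R : realType) (d : nat) (lo hi : 'I_d -> R)
    (L : operator R d) (f g u : 'rV[R]_d -> R) : Prop :=
  [/\ loc_integrable (box lo hi) f,
      forall phi, test_function (box lo hi) phi ->
        op_distr (box lo hi) L u phi =
        (\int[leb R d]_(x in box lo hi) (f x * phi x))%R &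
      is_trace lo hi u g].

Definition Rnorm (R : realType) (d : nat) (lo hi : 'I_d -> R)
    (L : operator R d) (omth : R) (Y : ('rV[R]_d -> R) -> \bar R)
    (v : 'rV[R]_d -> R) : \bar R :=
  (Hm1norm (box lo hi) (op_distr (box lo hi) L v)
   + omth%:E * trace_norm lo hi Y v)%E.

Definition subvec (R : realType) (d : nat) (S : {set 'I_d}) (x : 'rV[R]_d) :
    'rV[R]_#|S| :=
  \row_j x ord0 (enum_val j).

Definition subbox (R : realType) (d : nat) (lo hi : 'I_d -> R)
    (S : {set 'I_d}) : set 'rV[R]_#|S| :=
  box (lo \o @enum_val _ (mem S)) (hi \o @enum_val _ (mem S)).
Arguments subbox {R d} lo hi S.

(* [h (x_S)] is a version of the conditional expectation of [u] given [x_S]. *)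
Definition is_cond_exp (R : realType) (d : nat)
    (mu : {measure set 'rV[R]_d -> \bar R}) (Om : set 'rV[R]_d)
    (u : 'rV[R]_d -> R) (S : {set 'I_d}) (h : 'rV[R]_#|S| -> R) : Prop :=
  [/\ measurable_fun setT h, mu.-integrable Om (EFin \o (h \o subvec S)) &
    forall B, measurable B ->
      (\int[mu]_(x in Om `&` subvec S @^-1` B) (h (subvec S x))%:E =
       \int[mu]_(x in Om `&` subvec S @^-1` B) (u x)%:E)%E].

Definition is_anova (R : realType) (d : nat)
    (mu : {measure set 'rV[R]_d -> \bar R}) (Om : set 'rV[R]_d)
    (u : 'rV[R]_d -> R) (uS : forall S : {set 'I_d}, 'rV[R]_#|S| -> R) : Prop :=
  [/\ mu.-integrable Om (EFin \o u),
      forall y, uS finset.set0 y = (\int[mu]_(x in Om) u x)%R &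
      forall S, S != finset.set0 ->
        exists2 h, is_cond_exp mu Om u h &
          forall x, Om x -> uS S (subvec S x) =
            h (subvec S x)
            - \sum_(T : {set 'I_d} | T \proper S) uS T (subvec T x)].

Definition block_sum (R : realType) (d : nat) (A : {set {set 'I_d}})
    (z : forall S : {set 'I_d}, 'rV[R]_#|S| -> R) (x : 'rV[R]_d) : R :=
  \sum_(S in A) z S (subvec S x).

Definition features (R : realType) (d : nat) (M : nat -> nat) :=
  forall S : {set 'I_d}, 'I_(M #|S|) -> 'rV[R]_#|S| -> R.

Definition coeffs (R : realType) (d : nat) (M : nat -> nat) :=
  forall S : {set 'I_d}, 'I_(M #|S|) -> R.

Definition random_feature (R : realType) (d : nat) (M : nat -> nat)
    (sigma : R -> R) (T : Type)
    (om : forall S : {set 'I_d}, 'I_(M #|S|) -> T -> 'rV[R]_#|S|)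
    (bi : forall S : {set 'I_d}, 'I_(M #|S|) -> T -> R)
    (t : T) : features R d M :=
  fun S m y => if S == finset.set0 then 1
               else sigma (\sum_j om S m t ord0 j * y ord0 j + bi S m t).

Definition block_fun (R : realType) (d : nat) (M : nat -> nat)
    (phi : features R d M) (c : coeffs R d M) (S : {set 'I_d})
    (y : 'rV[R]_#|S|) : R :=
  \sum_m c S m * phi S m y.
Arguments block_fun {R d M} phi c S y.

Definition trial_fun (R : realType) (d : nat) (M : nat -> nat)
    (A : {set {set 'I_d}}) (phi : features R d M) (c : coeffs R d M) :
    'rV[R]_d -> R :=
  block_sum A (block_fun phi c).

Definition block_space (R : realType) (d : nat) (M : nat -> nat)
    (phi : features R d M) (S : {set 'I_d}) : set ('rV[R]_#|S| -> R) :=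
  [set v | exists c : 'I_(M #|S|) -> R, v = fun y => \sum_m c m * phi S m y].
Arguments block_space {R d M} phi S.

Definition coeff_sqnorm (R : realType) (d : nat) (M : nat -> nat)
    (A : {set {set 'I_d}}) (c : coeffs R d M) : R :=
  \sum_(S in A) \sum_m c S m ^+ 2.

Definition C2_real (R : realType) (sigma : R -> R) : Prop :=
  [/\ forall x, derivable sigma x 1, forall x, derivable (derive1 sigma) x 1 &
      continuous (derive1 (derive1 sigma))].

Definition collocation_loss (R : realType) (d : nat) (M : nat -> nat)
    (A : {set {set 'I_d}}) (L : operator R d) (f g : 'rV[R]_d -> R)
    (Nint Nbc : nat) (xint : 'I_Nint -> 'rV[R]_d) (xbc : 'I_Nbc -> 'rV[R]_d)
    (ombc lreg : R) (phi : features R d M) (c : coeffs R d M) : R :=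
  Nint%:R^-1 *
    (\sum_n `|op_apply L (trial_fun A phi c) (xint n) - f (xint n)| ^+ 2)
  + ombc ^+ 2 / Nbc%:R *
    (\sum_n `|trial_fun A phi c (xbc n) - g (xbc n)| ^+ 2)
  + lreg * coeff_sqnorm A c.

Definition Kstar (d : nat) (A : {set {set 'I_d}}) : nat := \max_(S in A) #|S|.

Definition nblk (d : nat) (A : {set {set 'I_d}}) (k : nat) : nat :=
  #|[pred S in A | #|S| == k]|.

Definition block_budget (R : realType) (d : nat) (A : {set {set 'I_d}})
    (eta : R) (k : nat) : R :=
  eta / ((Kstar A)%:R * (nblk A k)%:R).

Definition feature_error (R : realType) (d : nat) (M : nat -> nat)
    (A : {set {set 'I_d}}) (erf : {set 'I_d} -> nat -> R -> R -> R)
    (Rrf eta : R) (k : nat) : R :=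
  if nblk A k == 0%N then 0
  else Num.sqrt (\sum_(S in A | #|S| == k)
                   erf S (M k) Rrf (block_budget A eta k) ^+ 2).

Definition block_bound (R : realType) (d : nat) (M : nat -> nat)
    (lo hi : 'I_d -> R) (uS : forall S : {set 'I_d}, 'rV[R]_#|S| -> R)
    (phi : features R d M) (S : {set 'I_d}) (e : R) : Prop :=
  (ereal_inf [set Hnorm 2 (subbox lo hi S) (uS S \- v)%R
             | v in block_space phi S] <= e%:E)%E.

Definition with_probability d (T : measurableType d) (R : realType)
    (P : probability T R) (p : R) (Q : set T) : Prop :=
  exists2 E : set T, measurable E & E `<=` Q /\ (p%:E <= P E)%E.

(* For almost every outcome [t] of the first experiment with [G t], the event
   [Q (t, -)] has probability at least [p] in the second one; the joint event
   witnessing this is measurable. *)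
Definition conditionally_with_probability d1 d2 (T1 : measurableType d1)
    (T2 : measurableType d2) (R : realType) (P1 : probability T1 R)
    (P2 : probability T2 R) (G : set T1) (p : R) (Q : set (T1 * T2)) : Prop :=
  exists E : set (T1 * T2),
    [/\ measurable E, forall t s, G t -> E (t, s) -> Q (t, s) &
        {ae P1, forall t, G t -> (p%:E <= P2 (xsection E t))%E}].

(* Main.v *)
Require Import Defs.
From HB Require Import structures.
From mathcomp Require Import all_boot all_order all_algebra.
From mathcomp Require Import all_classical all_reals all_analysis.
From mathcomp Require Import ring lra.
Set Implicit Arguments.
Unset Strict Implicit.
Unset Printing Implicit Defensive.
Import Order.TTheory GRing.Theory Num.Theory.
Import numFieldNormedType.Exports.
Local Open Scope classical_set_scope.
Local Open Scope ring_scope.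

(* The error splits as u - u^ = (u - u_A) + (u_A - u^dag) - (u^ - u^dag).
   Stability bounds the L^2 norms of the last two terms by their residual norms;
   block stability bounds the residual of u_A - u^dag by the feature errors,
   sampled stability that of u^ - u^dag by the residual of
   u^dag - u = - (u - u_A) - (u_A - u^dag).

   What makes these triangle inequalities available is that a function with
   finite residual norm lies in H^1 and has a trace: it is measurable and
   locally integrable, so the pairing of its distributional image with test
   functions is additive. The assumptions give finite residual norms for all
   three terms.

   On the probability side, the block budgets sum to at most eta_feat, and the
   joint event has probability at least
   (1 - eta_feat)(1 - eta_LS) >= 1 - eta_feat - eta_LS. *)

(** * Borel sets and continuous functions for the coordinate sigma-algebra *)

(** The sigma-algebra is generated by the coordinates, so cubes are measurable. An open set is the
    union of the cubes with rational centre and half-side 1/(k+1) that it contains, and there are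
    countably many of these. A cube not inside [U] is replaced by the empty set so that the union
    can range over all indices. *)
Lemma open_measurable_rV (R : realType) (n : nat) (U : set 'rV[R]_n) :
  open U -> measurable U.
Proof.
move=> oU.
pose C (p : 'rV[rat]_n * nat) : set 'rV[R]_n :=
  [set x | forall i, x ord0 i \in `]ratr (p.1 ord0 i) - p.2.+1%:R^-1,
                                    ratr (p.1 ord0 i) + p.2.+1%:R^-1[].
have mC p : measurable (C p).
  rewrite (_ : C p = \bigcap_(i in [set: 'I_n]) (@rV_coord R n i @^-1`
     `]ratr (p.1 ord0 i) - p.2.+1%:R^-1, ratr (p.1 ord0 i) + p.2.+1%:R^-1[%classic)).
    apply: fin_bigcap_measurable; first exact: finite_finset.
    move=> i _; rewrite -[X in measurable X]setTI.
    exact: measurable_rV_coord.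
  by apply/seteqP; split => x /= Cx i; [move=> _|]; exact: Cx.
pose F p := if `[< C p `<=` U >] then C p else set0.
rewrite (_ : U = \bigcup_p F p).
  apply: countable_bigcupT_measurable => [|p]; first exact: countableP.
  by rewrite /F; case: ifP.
apply/seteqP; split => [x Ux|x [p _]]; last first.
  by rewrite /F; case: asboolP => // + Cx; exact.
have /nbhs_ballP[e /= e0 xeU] := open_nbhs_nbhs (conj oU Ux).
(* Coordinates of two points of a cube of half-side h differ by less than 2h, hence the choice h <
   e/2. *)
have [k ke] : exists k, k.+1%:R^-1 < e / 2.
  have [k _ /(_ k)] := near_infty_natSinv_lt (PosNum (divr_gt0 e0 (ltr0n _ 2))).
  by move=> /(_ (leqnn _)) ?; exists k.
have /fin_all_exists[q qP] (i : 'I_n) : exists q : rat,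
    (ratr q : R) \in `]x ord0 i - k.+1%:R^-1, x ord0 i + k.+1%:R^-1[.
  by apply: rat_in_itvoo; rewrite ltrD2l gtrN// invr_gt0.
have xC : C (\row_i q i, k) x.
  move=> i; have := qP i; rewrite !in_itv/= mxE.
  by move: (k.+1%:R^-1 : R) => h /andP[? ?]; apply/andP; split; lra.
exists (\row_i q i, k) => //; rewrite /F; case: asboolP => // -[] y Cy.
apply: xeU; split => // a i; rewrite (ord1 a).
have := xC i; have := Cy i; rewrite !in_itv/= mxE /ball/= ltr_norml.
move: (k.+1%:R^-1 : R) ke => h he /andP[? ?] /andP[? ?].
by apply/andP; split; lra.
Qed.

Lemma compact_measurable_rV (R : realType) (n : nat) (K : set 'rV[R]_n) :
  compact K -> measurable K.
Proof.
move=> /(compact_closed (@norm_hausdorff _ _)) cK.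
by rewrite -[K]setCK; exact: measurableC (open_measurable_rV (closed_openC cK)).
Qed.

Lemma continuous_measurable_rV (R : realType) (n : nat) (D : set 'rV[R]_n)
    (f : 'rV[R]_n -> R) :
  open D -> (forall x, D x -> {for x, continuous f}) -> measurable_fun D f.
Proof.
move=> oD cf; apply: (measurability _ (measurable_realfun.RGenOpens.measurableE R)).
move=> _ [_ [a [b ->] <-]]; apply: open_measurable_rV.
rewrite openE => x [Dx fx]; apply: filterI; first exact: open_nbhs_nbhs.
by apply: cf => //; apply: open_nbhs_nbhs; split => //; exact: interval_open.
Qed.

Lemma open_box (R : realType) (n : nat) (lo hi : 'I_n -> R) : open (box lo hi).
Proof.
rewrite openE => x bx.
suff: nbhs x (fun y : 'rV[R]_n => forall i, lo i < y ord0 i < hi i) by [].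
apply: (@filter_forall _ _ (fun i (y : 'rV[R]_n) => lo i < y ord0 i < hi i)
  (nbhs x)) => i.
have cx : (fun y : 'rV[R]_n => y ord0 i) @ x --> x ord0 i.
  exact: coord_continuous.
apply: (cx [set y | lo i < y < hi i]).
have := @near_in_itvoo R (lo i) (hi i) (x ord0 i).
by rewrite in_itv/= => /(_ (bx i)); apply: filterS => y; rewrite in_itv.
Qed.

Lemma measurable_box (R : realType) (n : nat) (lo hi : 'I_n -> R) :
  measurable (box lo hi).
Proof. by apply: open_measurable_rV; exact: open_box. Qed.

(** * Calculus of C^k functions, supports, and integrability against test functions *)

Section Ck_theory.
Context (R : realType) (n : nat).
Implicit Types (D K : set 'rV[R]_n) (f g : 'rV[R]_n -> R).

Lemma near_open_eq D f g x : open D -> (forall y, D y -> f y = g y) -> D x ->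
  \forall y \near x, f y = g y.
Proof. by move=> oD fg Dx; apply: filterS fg _; exact: open_nbhs_nbhs. Qed.

Lemma partial_ext D f g i : open D -> (forall x, D x -> f x = g x) ->
  forall x, D x -> partial i f x = partial i g x.
Proof.
move=> oD fg x Dx; apply: near_eq_derive; exact: near_open_eq oD fg Dx.
Qed.

Lemma Ck_continuous k D f : Ck k D f -> forall x, D x -> {for x, continuous f}.
Proof. by case: k => [|k] []. Qed.

Lemma continuous_at_ext D f g x : open D -> (forall y, D y -> f y = g y) ->
  D x -> {for x, continuous f} -> {for x, continuous g}.
Proof.
move=> oD fg Dx cf; suff: g @ x --> f x by rewrite (fg x Dx).
by apply: cvg_trans cf; exact: near_eq_cvg (near_open_eq oD fg Dx).
Qed.

(** Continuity and derivatives at a point depend only on values nearby, which an open [D] controls.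
    This allows a partial derivative to be replaced by a formula valid on [D] alone, as the sum and
    product rules require. *)
Lemma Ck_ext k D f g : open D -> (forall x, D x -> f x = g x) ->
  Ck k D f -> Ck k D g.
Proof.
move=> oD; elim: k f g => [|k IH] f g fg [cf df].
  by split=> // x Dx; exact: continuous_at_ext oD fg Dx (cf x Dx).
split=> [x Dx|i]; first exact: continuous_at_ext oD fg Dx (cf x Dx).
have [dfi Ci] := df i; split=> [x Dx|].
  by apply: near_eq_derivable (dfi x Dx); exact: near_open_eq oD fg Dx.
by apply: IH Ci; exact: partial_ext.
Qed.

Lemma CkW k D f : Ck k.+1 D f -> Ck k D f.
Proof.
elim: k f => [|k IH] f [cf df]; first by split.
by split=> // i; have [dfi /IH] := df i.
Qed.

Lemma Ckb_Ck k D f : Ckb k D f -> Ck k D f.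
Proof.
elim: k f => [|k IH] f [cf [_ df]]; first by split.
by split=> // i; have [dfi /IH] := df i.
Qed.

Lemma Ck_sub k D f : Ck k setT f -> Ck k D f.
Proof.
elim: k f => [|k IH] f [cf df]; first by split=> // x _; exact: cf.
split=> [x _|i]; first exact: cf.
have [dfi /IH ?] := df i; split => // x _; exact: dfi.
Qed.

Lemma CkD k D f g : open D -> Ck k D f -> Ck k D g -> Ck k D (f \+ g).
Proof.
move=> oD; elim: k f g => [|k IH] f g [cf df] [cg dg].
  by split=> // x Dx; apply: continuousD; [exact: cf|exact: cg].
split=> [x Dx|i]; first by apply: continuousD; [exact: cf|exact: cg].
have [dfi Cf] := df i; have [dgi Cg] := dg i; split => [x Dx|].
  by apply: derivableD; [exact: dfi|exact: dgi].
apply: Ck_ext (IH _ _ Cf Cg) => // x Dx.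
by rewrite /partial /= -deriveD; [|exact: dfi|exact: dgi].
Qed.

Lemma CkB k D f g : open D -> Ck k D f -> Ck k D g -> Ck k D (f \- g).
Proof.
move=> oD; elim: k f g => [|k IH] f g [cf df] [cg dg].
  by split=> // x Dx; apply: continuousB; [exact: cf|exact: cg].
split=> [x Dx|i]; first by apply: continuousB; [exact: cf|exact: cg].
have [dfi Cf] := df i; have [dgi Cg] := dg i; split => [x Dx|].
  by apply: derivableB; [exact: dfi|exact: dgi].
apply: Ck_ext (IH _ _ Cf Cg) => // x Dx.
by rewrite /partial /= -deriveB; [|exact: dfi|exact: dgi].
Qed.

Lemma CkM k D f g : open D -> Ck k D f -> Ck k D g -> Ck k D (f \* g).
Proof.
move=> oD; elim: k f g => [|k IH] f g Cf0 Cg0; have [cf df] := Cf0;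
    have [cg dg] := Cg0.
  by split=> // x Dx; apply: continuousM; [exact: cf|exact: cg].
split=> [x Dx|i]; first by apply: continuousM; [exact: cf|exact: cg].
have [dfi Cf] := df i; have [dgi Cg] := dg i; split => [x Dx|].
  by apply: derivableM; [exact: dfi|exact: dgi].
(* The product rule multiplies a derivative of one factor by the other factor itself, so the
   induction hypothesis also needs [f] and [g] at the lower order, given by [CkW]. *)
apply: Ck_ext (CkD oD (IH _ _ (CkW Cf0) Cg) (IH _ _ (CkW Cg0) Cf)) => // x Dx.
by rewrite /partial /= deriveM; [|exact: dfi|exact: dgi].
Qed.

Lemma Ck_cst k D (c : R) : Ck k D (cst c).
Proof.
elim: k c => [|k IH] c; first by split=> // x _; exact: cst_continuous.
split=> [x _|i]; first exact: cst_continuous.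
split=> [x _|]; first exact: derivable_cst.
rewrite (_ : partial i (cst c) = cst 0); first exact: IH.
by apply: funext => x; rewrite /partial derive_cst.
Qed.

Lemma Ck_sum k D (I : Type) (r : seq I) (F : I -> 'rV[R]_n -> R) : open D ->
  (forall i, Ck k D (F i)) -> Ck k D (fun x => \sum_(i <- r) F i x).
Proof.
move=> oD CF; elim: r => [|i r IH].
  by apply: Ck_ext (Ck_cst k D 0) => // x _; rewrite big_nil.
by apply: Ck_ext (CkD oD (CF i) IH) => // x _; rewrite big_cons.
Qed.

Lemma Ck_partial k D f i : Ck k.+1 D f -> Ck k D (partial i f).
Proof. by case=> _ /(_ i)[]. Qed.

(** Off the closed set [K] the function vanishes on a whole neighbourhood, so differentiation does
    not enlarge the support. *)
Lemma partial_eq0 K f i : closed K -> (forall x, ~ K x -> f x = 0) ->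
  forall x, ~ K x -> partial i f x = 0.
Proof.
move=> cK f0 x Kx.
rewrite (@partial_ext (~` K) f (cst 0))//; last exact: closed_openC.
by rewrite /partial derive_cst.
Qed.

Lemma mpartial_Ck k (al : multi_index n k) f :
  (forall m, Ck m setT f) -> forall m, Ck m setT (mpartial al f).
Proof.
move=> Cf; rewrite /mpartial; elim: (enum 'I_n) => [//|i s IH] /=.
by elim: (al i : nat) => [//|a IHa] m /=; exact/Ck_partial/IHa.
Qed.

Lemma mpartial_eq0 K k (al : multi_index n k) f : closed K ->
  (forall x, ~ K x -> f x = 0) -> forall x, ~ K x -> mpartial al f x = 0.
Proof.
move=> cK f0; rewrite /mpartial; elim: (enum 'I_n) => [//|i s IH] /=.
by elim: (al i : nat) => [//|a IHa] /=; exact: partial_eq0.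
Qed.

(** The adjoint differentiates [op_a] twice and [op_b] once, which matches the orders in
    [regular_coefficients]. What remains is continuous and can be paired with locally integrable
    functions. *)
Lemma op_adjoint_Ck0 D (L : operator R n) f : open D ->
  regular_coefficients D L -> (forall k, Ck k setT f) -> Ck 0 D (op_adjoint L f).
Proof.
move=> oD [ra rb rc] Cf; have CfD k : Ck k D f by exact: Ck_sub.
pose Sa x := \sum_i \sum_j partial i (partial j (op_a L i j \* f)) x.
pose Sb x := \sum_i partial i (op_b L i \* f) x.
have CSa : Ck 0 D Sa.
  apply: Ck_sum => // i; apply: Ck_sum => // j.
  by do 2! apply: Ck_partial; apply: CkM => //; apply: Ckb_Ck.
have CSb : Ck 0 D Sb.
  by apply: Ck_sum => // i; apply: Ck_partial; apply: CkM => //; apply: Ckb_Ck.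
have Cc : Ck 0 D (op_c L \* f) by apply: CkM => //; exact: Ckb_Ck.
apply: Ck_ext (CkD oD (CkB oD (CkB oD (Ck_cst 0 D 0) CSa) CSb) Cc) => // x _.
by rewrite /op_adjoint /= sub0r.
Qed.

Lemma op_adjoint_eq0 K (L : operator R n) f : closed K ->
  (forall x, ~ K x -> f x = 0) -> forall x, ~ K x -> op_adjoint L f x = 0.
Proof.
move=> cK f0 x Kx.
have h0 (h : 'rV[R]_n -> R) y : ~ K y -> (h \* f) y = 0.
  by move=> Ky /=; rewrite f0// mulr0.
rewrite /op_adjoint f0// mulr0 addr0 !big1 ?oppr0 ?addr0// => i _.
  by apply: partial_eq0 Kx => // y; exact: h0.
rewrite big1// => j _.
by apply: partial_eq0 Kx => // y; apply: partial_eq0 => // z; exact: h0.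
Qed.

(** On the compact [K] the factor [f] is integrable and the continuous factor [g] is bounded; off
    [K] the product is zero. This justifies splitting the integrals of all pairings with test
    functions below. *)
Lemma integrable_mul_continuous D K f g : open D -> compact K -> K `<=` D ->
  loc_integrable D f -> (forall x, D x -> {for x, continuous g}) ->
  (forall x, ~ K x -> g x = 0) ->
  (leb R n).-integrable D (EFin \o (f \* g)).
Proof.
move=> oD cK KD lf cg g0.
have mD : measurable D by exact: open_measurable_rV.
have mK := compact_measurable_rV cK.
(* Extending by zero identifies integrability on [D] with integrability on [K]. *)
apply/(integrable_mkcond _ mD).
rewrite (_ : _ \_ D = (EFin \o (f \* g)) \_ K); last first.
  apply: funext => x; rewrite !patchE; case: ifPn => xD; case: ifPn => xK //=.
    by rewrite g0 ?mulr0// => Kx; rewrite mem_set in xK.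
  by rewrite (mem_set (KD _ (set_mem xK))) in xD.
apply/(integrable_mkcond _ mK).
rewrite (_ : EFin \o _ = (EFin \o f) \* (EFin \o g))%E; last by apply: funext.
apply: integrableMl => //; first exact: lf.
  by apply: measurable_funS (continuous_measurable_rV oD cg).
have : compact (g @` K).
  apply: continuous_compact => //; apply: continuous_in_subspaceT => x /set_mem Kx.
  by apply: cg; exact: KD.
move=> /compact_bounded; rewrite /bounded_set /bounded_near /= => b.
by apply: filterS b => M bM x Kx; apply: bM; exists x.
Qed.

End Ck_theory.

(** * Triangle inequalities for infima and for finite l2 sums *)

(** Serves every norm defined as an infimum over representatives: elements within e/2 of the two
    infima combine into one of [C]. An infinite infimum makes the right-hand side infinite. *)
Lemma ereal_inf_leD (R : realType) (A B C : set \bar R) :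
  (forall a, A a -> (0 <= a)%E) -> (forall b, B b -> (0 <= b)%E) ->
  (forall a b, A a -> B b -> exists2 c, C c & (c <= a + b)%E) ->
  (ereal_inf C <= ereal_inf A + ereal_inf B)%E.
Proof.
move=> A0 B0 ABC.
have iA0 : (0 <= ereal_inf A)%E by exact/ereal_infP.
have iB0 : (0 <= ereal_inf B)%E by exact/ereal_infP.
have [->|iAoo] := eqVneq (ereal_inf A) +oo%E.
  by rewrite addye ?leey// -ltNye (lt_le_trans _ iB0).
have [->|iBoo] := eqVneq (ereal_inf B) +oo%E.
  by rewrite addey ?leey// -ltNye (lt_le_trans _ iA0).
have fA : ereal_inf A \is a fin_num by rewrite ge0_fin_numE// ltey.
have fB : ereal_inf B \is a fin_num by rewrite ge0_fin_numE// ltey.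
apply/lee_addgt0Pr => e e0; have e20 : 0 < e / 2 by rewrite divr_gt0.
have [a Aa ae] := lb_ereal_inf_adherent e20 fA.
have [b Bb be] := lb_ereal_inf_adherent e20 fB.
have [c Cc cab] := ABC _ _ Aa Bb.
apply: (le_trans (ereal_inf_lbound Cc)); apply: (le_trans cab).
rewrite [e in leRHS]splitr EFinD addeACA.
by apply: leeD; exact: ltW.
Qed.

(** Minkowski's inequality in l2: after squaring, only the cross term remains, and Cauchy-Schwarz
    bounds it. *)
Lemma sqrt_sum_leD (R : realType) (I : finType) (P : pred I) (a b c : I -> R) :
  (forall i, P i -> 0 <= c i <= a i + b i) ->
  Num.sqrt (\sum_(i | P i) c i ^+ 2) <=
  Num.sqrt (\sum_(i | P i) a i ^+ 2) + Num.sqrt (\sum_(i | P i) b i ^+ 2).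
Proof.
move=> cab; have sq_ge0 (f : I -> R) : 0 <= \sum_(i | P i) f i ^+ 2.
  by apply: sumr_ge0 => i _; exact: sqr_ge0.
set A := Num.sqrt (\sum_(i | P i) a i ^+ 2).
set B := Num.sqrt (\sum_(i | P i) b i ^+ 2).
have A0 : 0 <= A by exact: sqrtr_ge0.
have B0 : 0 <= B by exact: sqrtr_ge0.
have A2 : \sum_(i | P i) a i ^+ 2 = A ^+ 2 by rewrite sqr_sqrtr.
have B2 : \sum_(i | P i) b i ^+ 2 = B ^+ 2 by rewrite sqr_sqrtr.
have ab : \sum_(i | P i) a i * b i <= A * B.
  (* Cauchy-Schwarz comes from a sum of squares equal to 2AB times the gap, so AB = 0 is treated
     apart: one of the two families is then identically zero. *)
  have [AB0|AB0] := eqVneq (A * B) 0.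
    rewrite AB0 big1// => i Pi; move/eqP: AB0; rewrite mulf_eq0.
    have z (f : I -> R) : \sum_(j | P j) f j ^+ 2 = 0 -> f i = 0.
      move/eqP; rewrite psumr_eq0; last by move=> j _; exact: sqr_ge0.
      by move=> /allP/(_ i (mem_index_enum _)); rewrite Pi sqrf_eq0 => /eqP.
    move=> /orP[] /eqP X0.
      by rewrite (z a) ?mul0r// A2 X0 expr0n.
    by rewrite (z b) ?mulr0// B2 X0 expr0n.
  have ABp : 0 < A * B by rewrite lt0r AB0 mulr_ge0.
  rewrite -subr_ge0 -(pmulr_rge0 _ (mulr_gt0 (ltr0n _ 2) ABp)).
  (* this is [\sum_i (B * a i - A * b i) ^+ 2] *)
  rewrite (_ : _ * _ * _ = B ^+ 2 * A ^+ 2 + A ^+ 2 * B ^+ 2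
     - 2 * (A * B) * \sum_(i | P i) a i * b i); last by ring.
  rewrite -[in X in X + _ - _]A2 -[in X in _ + X - _]B2 !mulr_sumr -big_split -sumrB.
  apply: sumr_ge0 => i _ /=.
  rewrite (_ : _ - _ = (B * a i - A * b i) ^+ 2); first exact: sqr_ge0.
  by ring.
rewrite -(@ler_pXn2r _ 2)// ?nnegrE ?sqrtr_ge0 ?addr_ge0// sqr_sqrtr//.
apply: (@le_trans _ _ (\sum_(i | P i) (a i + b i) ^+ 2)).
  apply: ler_sum => i Pi; have /andP[c0 cle] := cab i Pi.
  by rewrite ler_pXn2r// nnegrE (le_trans c0).
under eq_bigr do rewrite sqrrD.
rewrite big_split big_split/= A2 B2 sumrMnl sqrrD.
by rewrite lerD2r lerD2l lerMn2r ab orbT.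
Qed.

Local Open Scope ereal_scope.

Lemma lee_sum_term (R : realType) (I : finType) (P : pred I) (f : I -> \bar R) i :
  (forall j, P j -> 0 <= f j) -> P i -> f i <= \sum_(j | P j) f j.
Proof.
move=> f0 Pi; rewrite (bigD1 i)//= leeDl// sume_ge0// => j /andP[Pj _].
exact: f0.
Qed.

Lemma poweR2V_EFin (R : realType) (x : R) : (0 <= x)%R ->
  x%:E `^ 2^-1 = (Num.sqrt x)%:E.
Proof. by move=> x0; rewrite poweR_EFin powR12_sqrt. Qed.

Lemma poweR2V_lty (R : realType) (x : \bar R) : 0 <= x ->
  (x `^ 2^-1 < +oo) = (x < +oo).
Proof.
case: x => [x||]//= x0; first by rewrite !ltry.
by rewrite invr_eq0 pnatr_eq0.
Qed.

Lemma expe2_lty (R : realType) (x : \bar R) : 0 <= x -> x ^+ 2 < +oo -> x < +oo.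
Proof. by case: x => [r||]//; rewrite ?ltry// expe2 mulyy. Qed.

(** Either one of the right-hand norms is infinite and the bound is trivial, or every term is finite
    and the real inequality applies. *)
Lemma poweR2V_sum_leD (R : realType) (I : finType) (P : pred I)
    (a b c : I -> \bar R) :
  (forall i, P i -> 0 <= a i) -> (forall i, P i -> 0 <= b i) ->
  (forall i, P i -> 0 <= c i <= a i + b i) ->
  (\sum_(i | P i) c i ^+ 2) `^ 2^-1 <=
  (\sum_(i | P i) a i ^+ 2) `^ 2^-1 + (\sum_(i | P i) b i ^+ 2) `^ 2^-1.
Proof.
move=> a0 b0 cab.
have fin (f : I -> \bar R) : (forall i, P i -> 0 <= f i) ->
    (\sum_(i | P i) f i ^+ 2) `^ 2^-1 = +oo \/
    forall i, P i -> f i = (fine (f i))%:E.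
  move=> f0; have f20 : 0 <= \sum_(i | P i) f i ^+ 2.
    by apply: sume_ge0 => i Pi; exact/expe_ge0/f0.
  have [foo|] := ltP ((\sum_(i | P i) f i ^+ 2) `^ 2^-1) +oo; last first.
    by rewrite leye_eq => /eqP; left.
  right=> i Pi; rewrite fineK// ge0_fin_numE ?f0//.
  move: foo; rewrite poweR2V_lty// => foo.
  have := le_lt_trans (lee_sum_term (fun j Pj => expe_ge0 2 (f0 j Pj)) Pi) foo.
  by apply: expe2_lty; exact: f0.
have [->|fa] := fin a a0; first by rewrite addye ?leey// -ltNye (lt_le_trans _ (poweR_ge0 _ _)).
have [->|fb] := fin b b0; first by rewrite addey ?leey// -ltNye (lt_le_trans _ (poweR_ge0 _ _)).
have fc i : P i -> c i = (fine (c i))%:E.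
  move=> Pi; have /andP[c0 cle] := cab i Pi.
  by rewrite fineK// ge0_fin_numE// (le_lt_trans cle)// fa// fb// -EFinD ltry.
have E (f : I -> \bar R) : (forall i, P i -> f i = (fine (f i))%:E) ->
    (\sum_(i | P i) f i ^+ 2) `^ 2^-1 =
    (Num.sqrt (\sum_(i | P i) fine (f i) ^+ 2)%R)%:E.
  move=> ff; rewrite -poweR2V_EFin; last by apply: sumr_ge0 => i _; exact: sqr_ge0.
  rewrite -sumEFin; congr (_ `^ _); apply: eq_bigr => i Pi.
  by rewrite [in LHS]ff// EFin_expe.
rewrite !E// -EFinD lee_fin; apply: sqrt_sum_leD => i Pi.
by rewrite -!lee_fin EFinD -fc// -fa// -fb//; exact: cab.
Qed.
Lemma poweR2_sqr (R : realType) (x : \bar R) : 0 <= x -> x `^ 2 = x ^+ 2.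
Proof.
case: x => [x||]//= x0; last by rewrite pnatr_eq0.
by rewrite powR_mulrn// expr2 EFinM.
Qed.

(** * The L^2 norm on a set *)

Section L2norm_theory.
Context (R : realType) (n : nat).
Implicit Types (Om : set 'rV[R]_n) (v w : 'rV[R]_n -> R).

Lemma L2norm_ge0 Om v : 0 <= L2norm Om v.
Proof. exact: Lnorm_ge0. Qed.

Lemma L2normB Om v w : measurable Om -> measurable_fun Om v ->
  measurable_fun Om w -> L2norm Om (v \- w)%R <= L2norm Om v + L2norm Om w.
Proof.
move=> mOm mv mw; rewrite /L2norm -(oppe_Lnorm _ (EFin \o w \_ Om)).
have -> : (\- (EFin \o w \_ Om)) = EFin \o ((\- w)%R \_ Om).
  by apply: funext => x /=; rewrite !patchE; case: ifP => _; rewrite ?oppr0.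
have -> : (v \- w)%R \_ Om = ((v \_ Om) \+ ((\- w) \_ Om))%R.
  by apply: funext => x /=; rewrite !patchE; case: ifP => _; rewrite ?addr0.
apply: minkowski_EFin; last by rewrite ler1n.
- exact: (measurable_restrictT _ mOm).1.
- by apply: (measurable_restrictT _ mOm).1; exact: measurable_realfun.measurable_funN.
Qed.

Lemma L2norm_cst0 Om : L2norm Om (cst 0%R) = 0.
Proof.
rewrite /L2norm (_ : EFin \o _ = cst 0); last first.
  by apply: funext => x /=; rewrite patchE; case: ifP.
by rewrite Lnorm0// eqe pnatr_eq0.
Qed.

Lemma integral_sqr_L2norm Om v : measurable Om ->
  \int[leb R n]_(x in Om) (`|v x| ^+ 2)%:E = L2norm Om v ^+ 2.
Proof.
move=> mOm; rewrite -poweR2_sqr ?L2norm_ge0// poweR_Lnorm//.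
rewrite [LHS]integral_mkcond; apply: eq_integral => x _.
rewrite /= !patchE /=; case: ifP => _; rewrite powR_mulrn//.
by rewrite normr0 expr0n.
Qed.

End L2norm_theory.

(** * Weak derivatives and Sobolev norms *)

Section Hnorm_theory.
Context (R : realType) (n : nat).
Implicit Types (Om : set 'rV[R]_n) (v w : 'rV[R]_n -> R).

Lemma loc_integrableB Om v w : loc_integrable Om v -> loc_integrable Om w ->
  loc_integrable Om (v \- w)%R.
Proof.
move=> lv lw K cK KOm.
have mK := compact_measurable_rV cK.
exact: (integrableB mK (lv K cK KOm) (lw K cK KOm)).
Qed.

(** The integral identities subtract because each pairing is integrable: the test function and its
    derivatives are continuous and supported in one compact set. *)
Lemma weak_derivativeB k Om (al : multi_index n k) v w v' w' : open Om ->
  weak_derivative Om al v v' -> weak_derivative Om al w w' ->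
  weak_derivative Om al (v \- w)%R (v' \- w')%R.
Proof.
move=> oOm [lv lv' vv'] [lw lw' ww']; split; try exact: loc_integrableB.
move=> phi tphi; have [Cphi [K [cK KOm] phi0]] := tphi.
have mOm : measurable Om by exact: open_measurable_rV.
have clK : closed K by exact: compact_closed (@norm_hausdorff _ _) cK.
have im f : loc_integrable Om f ->
    (leb R n).-integrable Om (EFin \o (f \* mpartial al phi)%R).
  move=> lf; apply: integrable_mul_continuous lf _ _; [exact: oOm|exact: cK|exact: KOm| |].
    by move=> x _; exact: (Ck_continuous (mpartial_Ck al Cphi 0%N) I).
  exact: mpartial_eq0.
have ip f : loc_integrable Om f ->
    (leb R n).-integrable Om (EFin \o (f \* phi)%R).
  move=> lf; apply: integrable_mul_continuous lf _ _; [exact: oOm|exact: cK|exact: KOm| |].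
    by move=> x _; exact: (Ck_continuous (Cphi 0%N) I).
  exact: phi0.
under eq_Rintegral do rewrite /= mulrBl.
rewrite RintegralB//; [|exact: im|exact: im].
under [in RHS]eq_Rintegral do rewrite /= mulrBl.
rewrite RintegralB//; [|exact: ip|exact: ip].
by rewrite vv'// ww'// mulrBr.
Qed.

Lemma Hnorm_set_ge0 k Om v y :
  [set ((\sum_(al : multi_index n k | (order_of al <= k)%N)
          (L2norm Om (w al)) ^+ 2) `^ 2^-1)
            | w in weak_derivatives Om v] y -> 0 <= y.
Proof. by move=> [w _ <-]; exact: poweR_ge0. Qed.

Lemma Hnorm_ge0 k Om v : 0 <= Hnorm k Om v.
Proof. by apply/ereal_infP => y; exact: Hnorm_set_ge0. Qed.

(** Families of weak derivatives of [v] and [w] subtract to one for the difference. Minkowski is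
    applied twice, in L^2 for each multi-index and in l2 over the multi-indices, before passing to
    infima. *)
Lemma HnormB k Om v w : open Om ->
  Hnorm k Om (v \- w)%R <= Hnorm k Om v + Hnorm k Om w.
Proof.
move=> oOm; have mOm : measurable Om by exact: open_measurable_rV.
apply: ereal_inf_leD; [exact: Hnorm_set_ge0|exact: Hnorm_set_ge0|].
move=> _ _ [v' [v'0 dv'] <-] [w' [w'0 dw'] <-].
exists ((\sum_(al : multi_index n k | (order_of al <= k)%N)
          (L2norm Om (v' al \- w' al)%R) ^+ 2) `^ 2^-1).
  exists (fun al => (v' al \- w' al)%R) => //; split; first by rewrite v'0 w'0.
  move=> al /[dup] /dv'[mv Dv] /dw'[mw Dw]; split; last exact: weak_derivativeB.
  exact: measurable_realfun.measurable_funB.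
apply: poweR2V_sum_leD => al kal; try exact: L2norm_ge0.
rewrite L2norm_ge0/=; have [mv _] := dv' al kal; have [mw _] := dw' al kal.
exact: L2normB.
Qed.

Lemma Hnorm_cst0 k Om : Hnorm k Om (cst 0%R) = 0.
Proof.
apply/eqP; rewrite eq_le Hnorm_ge0 andbT; apply: ereal_inf_lbound.
exists (fun=> cst 0%R); last first.
  rewrite big1 ?poweR2V_EFin ?sqrtr0// => al _.
  by rewrite L2norm_cst0 expe2 mule0.
split=> // al _; split; first exact: measurable_cst.
have l0 : loc_integrable Om (cst 0%R).
  move=> K cK _; rewrite (_ : EFin \o _ = cst 0)//; exact: integrable0.
split=> // phi _.
by rewrite /Rintegral !integral0_eq ?mulr0// => x _; rewrite /= mul0r.
Qed.

(** A finite norm provides a family of weak derivatives, whose member at the zero multi-index is [v]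
    itself. *)
Lemma in_H_L2norm k Om v : in_H k Om v ->
  [/\ measurable_fun Om v, loc_integrable Om v & L2norm Om v < +oo].
Proof.
move=> /ereal_inf_lt[_ [w [w0 dw] <-]].
have o0 : (order_of ([ffun=> ord0] : multi_index n k) <= k)%N.
  by rewrite /order_of big1// => i _; rewrite ffunE.
have := dw _ o0; rewrite w0 => -[mv [lv _ _]].
rewrite poweR2V_lty; last by apply: sume_ge0 => al _; exact/expe_ge0/L2norm_ge0.
move=> /(le_lt_trans (lee_sum_term (fun al _ => expe_ge0 2 (L2norm_ge0 Om (w al))) o0)).
by rewrite w0 => /(expe2_lty (L2norm_ge0 _ _)).
Qed.

End Hnorm_theory.

(** * Boundary traces, the dual norm and the residual norm *)

Section Rnorm_theory.
Context (R : realType) (n : nat) (lo hi : 'I_n -> R).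
Hypothesis lohi : forall i, (lo i < hi i)%R.
Implicit Types (v w g h : 'rV[R]_n -> R) (Y : ('rV[R]_n -> R) -> \bar R).
Implicit Types (L : operator R n).

Lemma measurable_face i e : measurable_fun setT (face lo hi i e).
Proof.
apply: measurable_to_rV => j; case: (eqVneq j i) => [ji|ji].
  rewrite (_ : _ \o _ = cst (if e then hi i else lo i)); first exact: measurable_cst.
  by apply: funext => x; rewrite /= /rV_coord /face mxE ji eqxx.
rewrite (_ : _ \o _ = rV_coord j); first exact: measurable_rV_coord.
by apply: funext => x; rewrite /= /rV_coord /face mxE (negbTE ji).
Qed.

Lemma continuous_bd_measurable v : (forall x, {for x, continuous v}) ->
  bd_measurable lo hi v.
Proof.
move=> cv i e; apply: measurable_funTS.
apply: measurableT_comp (measurable_face i e).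
by apply: continuous_measurable_rV => [|x _]; [exact: openT|exact: cv].
Qed.

Lemma bd_measurableB g h : bd_measurable lo hi g -> bd_measurable lo hi h ->
  bd_measurable lo hi (g \- h)%R.
Proof.
by move=> mg mh i e; exact: (measurable_realfun.measurable_funB (mg i e) (mh i e)).
Qed.

(** Moving the square root of each face weight inside the square exhibits the boundary norm as an l2
    norm over the faces, to which Minkowski applies. *)
Lemma bd_L2normE g : bd_L2norm lo hi g =
  (\sum_(p : 'I_n * bool) ((Num.sqrt (hi p.1 - lo p.1)^-1)%:E *
     L2norm (box lo hi) (g \o face lo hi p.1 p.2)) ^+ 2) `^ 2^-1.
Proof.
rewrite /bd_L2norm pair_bigA/=; congr (_ `^ _); apply: eq_bigr => -[i e] _ /=.
rewrite (integral_sqr_L2norm (g \o face lo hi i e) (measurable_box lo hi)).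
rewrite expe2 [RHS]muleACA -EFinM -expr2 sqr_sqrtr//.
by rewrite invr_ge0 subr_ge0 ltW.
Qed.

Lemma bd_L2normB g h : bd_measurable lo hi g -> bd_measurable lo hi h ->
  bd_L2norm lo hi (g \- h)%R <= bd_L2norm lo hi g + bd_L2norm lo hi h.
Proof.
move=> mg mh; rewrite !bd_L2normE.
have c0 i : 0 <= (Num.sqrt (hi i - lo i)^-1)%:E by rewrite lee_fin sqrtr_ge0.
apply: poweR2V_sum_leD => -[i e] _ /=.
- by rewrite mule_ge0// L2norm_ge0.
- by rewrite mule_ge0// L2norm_ge0.
- rewrite mule_ge0 ?L2norm_ge0//= -ge0_muleDr ?L2norm_ge0//.
  apply: lee_wpmul2l => //; apply: L2normB; [exact: measurable_box|exact: mg|exact: mh].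
Qed.

Lemma bd_L2norm_ge0 g : 0 <= bd_L2norm lo hi g.
Proof. exact: poweR_ge0. Qed.

Lemma bd_L2norm_cst0 : bd_L2norm lo hi (cst 0%R) = 0.
Proof.
rewrite bd_L2normE big1 ?poweR2V_EFin ?sqrtr0// => p _.
by rewrite L2norm_cst0 mule0 expe2 mule0.
Qed.

(** The difference of the approximating sequences approximates the difference; both errors are
    squeezed between 0 and a sum of errors that tend to 0. The approximants are continuous
    everywhere, hence measurable on the faces. *)
Lemma is_traceB v w g h : is_trace lo hi v g -> is_trace lo hi w h ->
  is_trace lo hi (v \- w)%R (g \- h)%R.
Proof.
move=> [Hv [mg goo] [phi [Cphi vphi gphi]]] [Hw [mh hoo] [psi [Cpsi wpsi hpsi]]].
have rearr (a b c d : 'rV[R]_n -> R) :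
    ((a \- b) \- (c \- d) = (a \- c) \- (b \- d))%R.
  by apply: funext => x /=; rewrite !opprB addrACA [RHS]addrACA; ring.
split.
- exact: le_lt_trans (HnormB 1 v w (@open_box _ _ lo hi)) (lte_add_pinfty Hv Hw).
- split; first exact: bd_measurableB.
  by apply: le_lt_trans (bd_L2normB mg mh) _; rewrite lte_add_pinfty.
- exists (fun m => phi m \- psi m)%R; split.
  + by move=> m; apply: CkB => //; exact: openT.
  + apply: (@squeeze_cvge _ _ _ _ (cst 0) _ (fun m =>
        Hnorm 1 (box lo hi) (v \- phi m)%R + Hnorm 1 (box lo hi) (w \- psi m)%R)).
    * apply: nearW => m /=; rewrite Hnorm_ge0/= rearr; apply: HnormB.
      exact: open_box.
    * exact: cvg_cst.
    * by rewrite -[X in _ --> X](adde0 0); apply: cvgeD.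
  + apply: (@squeeze_cvge _ _ _ _ (cst 0) _ (fun m =>
        bd_L2norm lo hi (g \- phi m)%R + bd_L2norm lo hi (h \- psi m)%R)).
    * apply: nearW => m /=; rewrite bd_L2norm_ge0/= rearr; apply: bd_L2normB.
        apply: bd_measurableB mg _; apply: continuous_bd_measurable => x.
        exact: (Ck_continuous (Cphi m) I).
      apply: bd_measurableB mh _; apply: continuous_bd_measurable => x.
      exact: (Ck_continuous (Cpsi m) I).
    * exact: cvg_cst.
    * by rewrite -[X in _ --> X](adde0 0); apply: cvgeD.
Qed.

Lemma is_trace_cst0 : is_trace lo hi (cst 0%R) (cst 0%R).
Proof.
have sub0 : (cst 0 \- cst 0 = cst 0 :> ('rV[R]_n -> R))%R.
  by apply: funext => x /=; rewrite subr0.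
split; first by rewrite /in_H Hnorm_cst0 ltry.
- split; last by rewrite bd_L2norm_cst0 ltry.
  by apply: continuous_bd_measurable => x; exact: cst_continuous.
- exists (fun=> cst 0%R); split; first by move=> m; exact: Ck_cst.
    by rewrite sub0 Hnorm_cst0; exact: cvg_cst.
  by rewrite sub0 bd_L2norm_cst0; exact: cvg_cst.
Qed.

Lemma trace_spaceB Y g h : trace_space lo hi Y -> Y (g \- h)%R <= Y g + Y h.
Proof.
move=> hY; rewrite -[Y h]mul1e -(normrN1 R) -(trace_spaceZ hY).
rewrite (_ : (g \- h)%R = (g \+ (-1 \*o h))%R); first exact: (trace_spaceD hY).
by apply: funext => x /=; rewrite mulN1r.
Qed.

Lemma trace_space_cst0 Y : trace_space lo hi Y -> Y (cst 0%R) = 0.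
Proof.
move=> hY; have := trace_spaceZ hY 0%R (cst 0%R); rewrite normr0 mul0e => <-.
by congr Y; apply: funext => x /=; rewrite mul0r.
Qed.

Lemma trace_norm_ge0 Y v : trace_space lo hi Y -> 0 <= trace_norm lo hi Y v.
Proof. by move=> hY; apply/ereal_infP => _ [g _ <-]; exact: trace_space_ge0 hY _. Qed.

Lemma trace_normB Y v w : trace_space lo hi Y ->
  trace_norm lo hi Y (v \- w)%R <= trace_norm lo hi Y v + trace_norm lo hi Y w.
Proof.
move=> hY; apply: ereal_inf_leD.
- by move=> _ [g _ <-]; exact: trace_space_ge0 hY _.
- by move=> _ [g _ <-]; exact: trace_space_ge0 hY _.
- move=> _ _ [g vg <-] [h wh <-]; exists (Y (g \- h)%R).
    by exists (g \- h)%R => //; exact: is_traceB.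
  exact: trace_spaceB.
Qed.

Lemma trace_norm_cst0 Y : trace_space lo hi Y -> trace_norm lo hi Y (cst 0%R) = 0.
Proof.
move=> hY; apply/eqP; rewrite eq_le trace_norm_ge0// andbT.
apply: ereal_inf_lbound; exists (cst 0%R); first exact: is_trace_cst0.
exact: trace_space_cst0.
Qed.

Lemma Hm1norm_ge0 (F : ('rV[R]_n -> R) -> R) : 0 <= Hm1norm (box lo hi) F.
Proof.
apply: (@le_trans _ _ (`|F (cst 0%R)|)%:E); first by rewrite lee_fin.
apply: ereal_sup_ubound; exists (cst 0%R) => //; split.
  split; first by move=> k; exact: Ck_cst.
  by exists set0 => //; split; [exact: compact0|exact: sub0set].
by rewrite Hnorm_cst0.
Qed.

Lemma op_distrB L v w phi : regular_coefficients (box lo hi) L ->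
  loc_integrable (box lo hi) v -> loc_integrable (box lo hi) w ->
  test_function (box lo hi) phi ->
  (op_distr (box lo hi) L (v \- w) phi =
   op_distr (box lo hi) L v phi - op_distr (box lo hi) L w phi)%R.
Proof.
move=> rL lv lw [Cphi [K [cK KOm] phi0]].
have oOm := @open_box _ _ lo hi.
have clK : closed K by exact: compact_closed (@norm_hausdorff _ _) cK.
have int f : loc_integrable (box lo hi) f ->
    (leb R n).-integrable (box lo hi) (EFin \o (f \* op_adjoint L phi)%R).
  move=> lf; apply: (integrable_mul_continuous oOm cK KOm lf).
    exact: (Ck_continuous (op_adjoint_Ck0 oOm rL Cphi)).
  exact: op_adjoint_eq0.
rewrite /op_distr; under eq_Rintegral do rewrite /= mulrBl.
by rewrite RintegralB//; [exact: measurable_box|exact: int|exact: int].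
Qed.

Lemma Hm1normB L v w : regular_coefficients (box lo hi) L ->
  loc_integrable (box lo hi) v -> loc_integrable (box lo hi) w ->
  Hm1norm (box lo hi) (op_distr (box lo hi) L (v \- w)%R) <=
  Hm1norm (box lo hi) (op_distr (box lo hi) L v) +
  Hm1norm (box lo hi) (op_distr (box lo hi) L w).
Proof.
move=> rL lv lw; apply: ge_ereal_sup => _ [phi [tphi phi1] <-].
rewrite op_distrB//; apply: (@le_trans _ _
   (`|op_distr (box lo hi) L v phi| + `|op_distr (box lo hi) L w phi|)%:E).
  by rewrite lee_fin ler_normB.
by rewrite EFinD; apply: leeD; apply: ereal_sup_ubound; exists phi.
Qed.

Lemma Hm1norm_cst0 L : Hm1norm (box lo hi) (op_distr (box lo hi) L (cst 0%R)) = 0.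
Proof.
apply/eqP; rewrite eq_le Hm1norm_ge0 andbT.
apply: ge_ereal_sup => _ [phi _ <-]; rewrite /op_distr /Rintegral integral0_eq//=.
  by rewrite normr0.
by move=> x _; rewrite mul0r.
Qed.

Context (omth : R) (Y : ('rV[R]_n -> R) -> \bar R).
Hypotheses (omth_gt0 : (0 < omth)%R) (hY : trace_space lo hi Y).

Lemma Rnorm_ge0 L v : 0 <= Rnorm lo hi L omth Y v.
Proof.
rewrite /Rnorm adde_ge0// ?Hm1norm_ge0// mule_ge0 ?trace_norm_ge0//.
by rewrite lee_fin ltW.
Qed.

Lemma Rnorm_cst0 L : Rnorm lo hi L omth Y (cst 0%R) = 0.
Proof. by rewrite /Rnorm Hm1norm_cst0 trace_norm_cst0// mule0 adde0. Qed.

(** Without a trace of finite [Y] norm the infimum in [trace_norm] is infinite, and the positive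
    weight [omth] passes this on to the residual norm. The definition of trace includes membership
    in H^1. *)
Lemma Rnorm_lty L v : Rnorm lo hi L omth Y v < +oo ->
  in_H 1 (box lo hi) v /\ exists2 h, is_trace lo hi v h & Y h < +oo.
Proof.
move=> Rv; have : trace_norm lo hi Y v < +oo.
  rewrite ltey; apply/eqP => too; move: Rv.
  by rewrite /Rnorm too gt0_muley ?lte_fin// addey// gt_eqF// (lt_le_trans _ (Hm1norm_ge0 _)).
by move=> /ereal_inf_lt[_ [h vh <-] Yh]; split; [case: vh|exists h].
Qed.

(** No finiteness is assumed: if either term on the right is infinite the bound is trivial, and
    otherwise both functions are locally integrable, as [Hm1normB] requires. *)
Lemma RnormB L v w : regular_coefficients (box lo hi) L ->
  Rnorm lo hi L omth Y (v \- w)%R <=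
  Rnorm lo hi L omth Y v + Rnorm lo hi L omth Y w.
Proof.
move=> rL.
have [Rv|] := ltP (Rnorm lo hi L omth Y v) +oo; last first.
  by rewrite leye_eq => /eqP ->; rewrite addye ?leey// gt_eqF// (lt_le_trans _ (Rnorm_ge0 _ _)).
have [Rw|] := ltP (Rnorm lo hi L omth Y w) +oo; last first.
  by rewrite leye_eq => /eqP ->; rewrite addey ?leey// gt_eqF// (lt_le_trans _ (Rnorm_ge0 _ _)).
have [/in_H_L2norm[_ lv _] _] := Rnorm_lty Rv.
have [/in_H_L2norm[_ lw _] _] := Rnorm_lty Rw.
rewrite /Rnorm addeACA; apply: leeD; first exact: Hm1normB.
rewrite -ge0_muleDr ?trace_norm_ge0//.
by apply: lee_wpmul2l; [rewrite lee_fin ltW|exact: trace_normB].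
Qed.

End Rnorm_theory.

Local Close Scope ereal_scope.

(** * Union bounds and the product of the two experiments *)

Section probability_events.
Context (R : realType) d1 d2 (T1 : measurableType d1) (T2 : measurableType d2).
Variables (P1 : probability T1 R) (P2 : probability T2 R).

(** Union bound on the complements of the two witnessing events. *)
Lemma with_probabilityI (a b : R) (A B : set T1) :
  with_probability P1 (1 - a) A -> with_probability P1 (1 - b) B ->
  with_probability P1 (1 - (a + b)) (A `&` B).
Proof.
move=> [E mE [EA PE]] [F mF [FB PF]]; exists (E `&` F); first exact: measurableI.
split; first exact: setISS.
have PC (X : set T1) (p : R) : measurable X ->
    ((1 - p)%:E <= P1 X)%E = (P1 (~` X) <= p%:E)%E.
  move=> mX; rewrite probability_setC// -(fineK (fin_num_measure P1 X mX)).
  by rewrite -EFinB !lee_fin; apply/idP/idP; lra.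
rewrite PC; last exact: measurableI.
rewrite setCI EFinD; apply: le_trans (measureU2 _ _ _) _; try exact: measurableC.
by apply: leeD; rewrite -PC.
Qed.

Lemma with_probability_forall (I : finType) (Q : pred I) (a : I -> R)
    (A : I -> set T1) :
  (forall i, Q i -> with_probability P1 (1 - a i) (A i)) ->
  with_probability P1 (1 - \sum_(i | Q i) a i) [set t | forall i, Q i -> A i t].
Proof.
move=> wpA.
suff [E mE [EA PE]] : with_probability P1 (1 - \sum_(i <- index_enum I | Q i) a i)
    [set t | forall i, i \in index_enum I -> Q i -> A i t].
  exists E => //; split=> // t /EA At i; exact: At (mem_index_enum i).
elim: (index_enum I) => [|i s IH].
  exists setT => //; rewrite big_nil subr0; split=> //.
  by rewrite (probability_setT P1).
rewrite big_cons; case: ifPn => Qi; last first.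
  have [E mE [EA PE]] := IH; exists E => //; split=> // t /EA At j.
  by rewrite in_cons => /orP[/eqP ->|]; [rewrite (negbTE Qi)|exact: At].
have [E mE [EA PE]] := with_probabilityI (wpA i Qi) IH.
exists E => //; split=> // t /EA[Ait At] j.
by rewrite in_cons => /orP[/eqP ->|]; [|exact: At].
Qed.

(** The product measure integrates the measure of sections. Over the witnessing event of [A], almost
    every section has probability at least 1 - b, so the total is at least (1 - a)(1 - b) = 1 - a -
    b + ab. *)
Lemma conditionally_with_probability_joint (a b : R) (A : set T1)
    (Q : set (T1 * T2)) : 0 <= a -> 0 <= b <= 1 ->
  with_probability P1 (1 - a) A ->
  conditionally_with_probability P1 P2 A (1 - b) Q ->
  exists2 E : set (T1 * T2),
    measurable E /\ ((1 - a - b)%:E <= (P1 \x P2) E)%E &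
    forall ts, E ts -> A ts.1 /\ Q ts.
Proof.
move=> a0 /andP[b0 b1] [G mG [GA PG]] [E [mE EQ EP]].
have mGT : measurable (G `*` [set: T2]) by exact: measurableX.
have mEG : measurable (E `&` G `*` [set: T2]) by exact: measurableI.
exists (E `&` G `*` [set: T2]); last first.
  by move=> [t s] [Ets [/= Gt _]]; split; [exact: GA|apply: EQ => //; exact: GA].
split=> //; rewrite /product_measure1.
have mx := measurable_fun_xsection P2 mEG.
apply: (@le_trans _ _ (\int[P1]_(t in G) (P2 \o xsection (E `&` G `*` [set: T2])) t)%E);
  last by apply: ge0_subset_integral.
apply: (@le_trans _ _ (\int[P1]_(t in G) (cst (1 - b)%:E) t)%E).
  rewrite integral_cst//.
  have [p Pp] : exists p, P1 G = p%:E.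
    by exists (fine (P1 G)); rewrite fineK// fin_num_measure.
  move: PG; rewrite Pp lee_fin => PG; rewrite [X in (_ * X)%E]Pp -EFinM lee_fin.
  have : (1 - b) * (1 - a) <= (1 - b) * p by rewrite ler_wpM2l// subr_ge0.
  by have := mulr_ge0 a0 b0; lra.
apply: ae_ge0_le_integral => //.
- by move=> t _; rewrite lee_fin subr_ge0.
- exact: measurable_funS mx.
- apply: filterS EP => t /= EPt Gt.
  by rewrite xsectionI in_xsectionX ?setIT ?mem_set//; exact/EPt/GA.
Qed.

End probability_events.

(** * Grouping blocks by size and distributing the failure budget *)

Section block_counting.
Context (R : realType) (d : nat) (A : {set {set 'I_d}}).

Lemma Kstar_ge S : S \in A -> (#|S| <= Kstar A)%N.
Proof. by move=> SA; exact: (@leq_bigmax_cond _ (mem A) (fun S : {set 'I_d} => #|S|)). Qed.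

Lemma nblk_gt0 S : S \in A -> (0 < nblk A #|S|)%N.
Proof. by move=> SA; apply/card_gt0P; exists S; rewrite inE SA eqxx. Qed.

(** After exchanging the sums, a nonempty block is counted exactly once, at k equal to its size,
    which lies between 1 and [Kstar A]. *)
Lemma block_sum_by_size (F : {set 'I_d} -> R) :
  \sum_(S in A | S != finset.set0) F S =
  \sum_(1 <= k < (Kstar A).+1) \sum_(S in A | #|S| == k) F S.
Proof.
under [RHS]eq_bigr do rewrite big_mkcondr.
rewrite exchange_big/= big_mkcondr; apply: eq_bigr => S SA.
rewrite -big_mkcond/=.
under eq_bigl do rewrite eq_sym.
by rewrite big_nat1_eq ltnS Kstar_ge// andbT card_gt0.
Qed.

Lemma block_budget_in01 (eta : R) S : 0 < eta < 1 -> S \in A ->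
  S != finset.set0 -> 0 < block_budget A eta #|S| < 1.
Proof.
move=> /andP[eta0 eta1] SA S0.
have Kn : (0 < Kstar A * nblk A #|S|)%N.
  by rewrite muln_gt0 nblk_gt0// andbT (leq_trans _ (Kstar_ge SA))// card_gt0.
rewrite /block_budget -natrM divr_gt0 ?ltr0n//=.
rewrite ltr_pdivrMr ?ltr0n// mul1r (lt_le_trans eta1)//.
by rewrite ler1n.
Qed.

(** Each size receives at most the share [eta / Kstar A], divided equally among its blocks, and
    there are [Kstar A] sizes. *)
Lemma sum_block_budget_le (eta : R) : 0 <= eta ->
  \sum_(S in A | S != finset.set0) block_budget A eta #|S| <= eta.
Proof.
move=> eta0; rewrite block_sum_by_size.
have H k : \sum_(S in A | #|S| == k) block_budget A eta #|S| <= eta / (Kstar A)%:R.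
  rewrite (eq_bigr (fun=> block_budget A eta k)); last by move=> S /andP[_ /eqP ->].
  rewrite sumr_const -/(nblk A k) /block_budget.
  (* A size without blocks leaves its share unspent, hence an inequality rather than an equality. *)
  have [->|n0] := eqVneq (nblk A k) 0%N; first by rewrite mulr0n divr_ge0.
  by rewrite -[leLHS]mulr_natr invfM mulrA mulfVK ?pnatr_eq0.
apply: (le_trans (ler_sum _ (fun k _ => H k))).
rewrite sumr_const_nat subn1/=.
have [->|K0] := eqVneq (Kstar A) 0%N; first by rewrite mulr0n.
by rewrite -[leLHS]mulr_natr mulfVK ?pnatr_eq0.
Qed.

Lemma sum_feature_error_sqr (M : nat -> nat)
    (erf : {set 'I_d} -> nat -> R -> R -> R) (Rrf eta : R) :
  \sum_(1 <= k < (Kstar A).+1) feature_error M A erf Rrf eta k ^+ 2 =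
  \sum_(S in A | S != finset.set0)
    erf S (M #|S|) Rrf (block_budget A eta #|S|) ^+ 2.
Proof.
rewrite block_sum_by_size; apply: eq_bigr => k _; rewrite /feature_error.
under [RHS]eq_bigr => S /andP[_ /eqP ->] do over.
case: eqVneq => [n0|_]; last by rewrite sqr_sqrtr// sumr_ge0// => S _; exact: sqr_ge0.
rewrite expr0n big_pred0// => S; apply/negP => /andP[SA /eqP Sk].
by have := nblk_gt0 SA; rewrite Sk n0.
Qed.

End block_counting.

(** * The error estimate on the joint event *)

Theorem theorem4p4 (R : realType) (d : nat) (hd : (0 < d)%N)
  (* domain and reference measure *)
  (lo hi : 'I_d -> R) (hlohi : forall i, lo i < hi i)
  (mui : 'I_d -> probability (measurableTypeR R) R)
  (hmui : forall i, mui i `]lo i, hi i[%classic = 1%E)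
  (* the elliptic problem and the residual norm *)
  (L : operator R d) (hreg : regular_coefficients (box lo hi) L)
  (hell : uniformly_elliptic (box lo hi) L)
  (f g u : 'rV[R]_d -> R) (hu : dirichlet_solution lo hi L f g u)
  (Y : ('rV[R]_d -> R) -> \bar R) (hY : trace_space lo hi Y)
  (omth : R) (homth : 0 < omth)
  (* ANOVA components and selected family *)
  (uS : forall S : {set 'I_d}, 'rV[R]_#|S| -> R)
  (huS : is_anova (prod_measure (fun i => mui i)) (box lo hi) u uS)
  (A : {set {set 'I_d}}) (hA0 : finset.set0 \in A)
  (hA1 : forall i : 'I_d, finset.set1 i \in A)
  (* random features, over the probability space (Tf, Pf) *)
  (M : nat -> nat) (hM0 : M 0%N = 1%N)
  (sigma : R -> R) (hsigma : C2_real sigma)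
  (df : measure_display) (Tf : measurableType df) (Pf : probability Tf R)
  (om : forall S : {set 'I_d}, 'I_(M #|S|) -> Tf -> 'rV[R]_#|S|)
  (hom : forall S m, measurable_fun setT (@om S m))
  (bi : forall S : {set 'I_d}, 'I_(M #|S|) -> Tf -> R)
  (hbi : forall S m, measurable_fun setT (@bi S m))
  (Rrf : R) (hRrf : 0 < Rrf)
  (* collocation points, over the probability space (Ts, Ps) *)
  (ds : measure_display) (Ts : measurableType ds) (Ps : probability Ts R)
  (Nint Nbc : nat) (hNint : (0 < Nint)%N) (hNbc : (0 < Nbc)%N)
  (xint : 'I_Nint -> Ts -> 'rV[R]_d)
  (hxint : forall n, measurable_fun setT (xint n))
  (hxint_in : forall n s, box lo hi (xint n s))
  (xbc : 'I_Nbc -> Ts -> 'rV[R]_d)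
  (hxbc : forall n, measurable_fun setT (xbc n))
  (hxbc_in : forall n s, (closure (box lo hi) `\` box lo hi) (xbc n s))
  (* fitted coefficients *)
  (ombc lreg : R) (hombc : 0 < ombc) (hlreg : 0 <= lreg)
  (chat : Tf -> Ts -> coeffs R d M)
  (hchat : forall t s (c : coeffs R d M),
     collocation_loss A L f g (xint ^~ s) (xbc ^~ s) ombc lreg
       (random_feature sigma om bi t) (chat t s) <=
     collocation_loss A L f g (xint ^~ s) (xbc ^~ s) ombc lreg
       (random_feature sigma om bi t) c)
  (* feature errors *)
  (erf : {set 'I_d} -> nat -> R -> R -> R)
  (herf : forall S m r eta, 0 <= erf S m r eta)
  (etaf etaLS : R) (hetaf : 0 < etaf < 1) (hetaLS : 0 < etaLS < 1)
  (heta : etaf + etaLS < 1)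
  (* (A1) *)
  (tausol taures : R) (htausol : 0 <= tausol) (htaures : 0 <= taures)
  (hA1sol : (L2norm (box lo hi) (u \- block_sum A uS)%R
             <= tausol%:E * L2norm (box lo hi) u)%E)
  (hA1res : (Rnorm lo hi L omth Y (u \- block_sum A uS)%R
             <= taures%:E * L2norm (box lo hi) u)%E)
  (hA1feat : forall (S : {set 'I_d}) (eta : R),
     S \in A -> S != finset.set0 -> 0 < eta < 1 ->
     with_probability Pf (1 - eta)
       [set t | block_bound lo hi uS (random_feature sigma om bi t) S
                  (erf S (M #|S|) Rrf eta)])
  (Bcoef : R) (cdag : Tf -> coeffs R d M)
  (good := [set t | forall S : {set 'I_d}, S \in A -> S != finset.set0 ->
              block_bound lo hi uS (random_feature sigma om bi t) S
                (erf S (M #|S|) Rrf (block_budget A etaf #|S|))])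
  (hcdag : forall t, good t ->
     [/\ block_fun (random_feature sigma om bi t) (cdag t) finset.set0
           = uS finset.set0,
         forall S : {set 'I_d}, S \in A -> S != finset.set0 ->
           (Hnorm 2 (subbox lo hi S)
              (uS S \- block_fun (random_feature sigma om bi t) (cdag t) S)%R
            <= (erf S (M #|S|) Rrf (block_budget A etaf #|S|))%:E)%E &
         Num.sqrt (coeff_sqnorm A (cdag t)) <= Bcoef])
  (* (A2) *)
  (Cell Cop Gam : R) (hCell : 0 < Cell) (hCop : 0 < Cop) (hGam : 0 < Gam)
  (hA2ell : forall e : 'rV[R]_d -> R, in_H 1 (box lo hi) e ->
     (exists2 h, is_trace lo hi e h & (Y h < +oo)%E) ->
     (L2norm (box lo hi) e <= Cell%:E * Rnorm lo hi L omth Y e)%E)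
  (hA2block : forall z : (forall S : {set 'I_d}, 'rV[R]_#|S| -> R),
     (forall S, S \in A -> in_H 2 (subbox lo hi S) (z S)) ->
     (Rnorm lo hi L omth Y (block_sum A z)
      <= (Cop * Num.sqrt Gam)%:E *
         (\sum_(S in A) Hnorm 2 (subbox lo hi S) (z S) ^+ 2) `^ 2^-1)%E)
  (* (A3) *)
  (chi := ((Num.sqrt Nint%:R)^-1 + (Num.sqrt Nbc%:R)^-1)
          * Num.sqrt (ln etaLS^-1))
  (Cls Csamp Creg : R) (hCls : 0 < Cls) (hCsamp : 0 < Csamp) (hCreg : 0 < Creg)
  (hA3 : conditionally_with_probability Pf Ps good (1 - etaLS)
     [set ts : Tf * Ts |
       let phi := random_feature sigma om bi ts.1 in
       let uhat := trial_fun A phi (chat ts.1 ts.2) in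
       let udag := trial_fun A phi (cdag ts.1) in
       (Rnorm lo hi L omth Y (uhat \- udag)%R
        <= Cls%:E * (Rnorm lo hi L omth Y (udag \- u)%R
                     + (Csamp * chi + Creg * Num.sqrt lreg * Bcoef)%:E))%E]) :
  exists2 E : set (Tf * Ts),
    measurable E /\ ((1 - etaf - etaLS)%:E <= (Pf \x Ps) E)%E &
    forall ts, E ts ->
      (L2norm (box lo hi)
         (u \- trial_fun A (random_feature sigma om bi ts.1) (chat ts.1 ts.2))%R
       <= (tausol + Cell * Cls * taures)%:E * L2norm (box lo hi) u
          + (Cell * (1 + Cls) *
             (Cop * Num.sqrt Gam *
                Num.sqrt (\sum_(1 <= k < (Kstar A).+1)
                            feature_error M A erf Rrf etaf k ^+ 2)
              + Csamp * chi + Creg * Num.sqrt lreg * Bcoef))%:E)%E.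
Proof.
have rL := hreg.
have [etaf0 _] := andP hetaf; have [etaLS0 etaLS1] := andP hetaLS.
have good_wp : with_probability Pf (1 - etaf) good.
  (* The feature assumption is taken at each block's own budget, so that the union bound costs at
     most [etaf]. *)
  have blk_wp S : (S \in A) && (S != finset.set0) ->
      with_probability Pf (1 - block_budget A etaf #|S|)
        [set t | block_bound lo hi uS (random_feature sigma om bi t) S
                   (erf S (M #|S|) Rrf (block_budget A etaf #|S|))].
    by move=> /andP[SA S0]; apply: hA1feat => //; exact: block_budget_in01.
  have [E mE [EG PE]] := with_probability_forall blk_wp.
  exists E => //; split; first by move=> t /EG Gt S SA S0; apply: Gt; rewrite /= SA.
  apply: le_trans PE; rewrite lee_fin lerD2l lerN2.
  exact: sum_block_budget_le (ltW etaf0).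
have [E [mE PE] EQ] := conditionally_with_probability_joint (ltW etaf0)
  (introT andP (conj (ltW etaLS0) (ltW etaLS1))) good_wp hA3.
exists E => // -[t s] /EQ[/= good_t R3].
have [zero_block block_err Bcoef_ge] := hcdag t good_t.
set phi := random_feature sigma om bi t in R3 zero_block block_err *.
set uhat := trial_fun A phi (chat t s) in R3 *.
set udag := trial_fun A phi (cdag t) in R3 *.
have [Hu _ _] : is_trace lo hi u g by case: hu.
have [_ _ L2u] := in_H_L2norm Hu.
(* The function [u] has a trace, so it lies in H^1 and its L^2 norm is a real number; the final
   comparison then takes place among reals. *)
have [N uN] : exists N, L2norm (box lo hi) u = N%:E.
  by exists (fine (L2norm (box lo hi) u)); rewrite fineK// ge0_fin_numE// L2norm_ge0.
rewrite uN in hA1sol hA1res *.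
set uA := block_sum A uS in hA1sol hA1res *.
have [H1 _] := Rnorm_lty homth (le_lt_trans hA1res (ltry _)).
pose z (S : {set 'I_d}) := (uS S \- block_fun phi (cdag t) S)%R.
have zE : (uA \- udag)%R = block_sum A z.
  by apply: funext => x; rewrite /= /uA /udag /trial_fun /block_sum -sumrB.
(* The constant component is reproduced exactly. Its error therefore drops out of the block sum,
   which leaves the sizes from 1 on. *)
have z0 : z finset.set0 = cst 0.
  by apply: funext => y; rewrite /z zero_block /= subrr.
pose err (S : {set 'I_d}) := erf S (M #|S|) Rrf (block_budget A etaf #|S|).
have Hz S : S \in A -> in_H 2 (subbox lo hi S) (z S).
  move=> SA; have [->|S0] := eqVneq S finset.set0.
    by rewrite /in_H z0 Hnorm_cst0 ltry.
  exact: le_lt_trans (block_err S SA S0) (ltry _).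
pose D := Cop * Num.sqrt Gam * Num.sqrt (\sum_(1 <= k < (Kstar A).+1)
            feature_error M A erf Rrf etaf k ^+ 2).
have R2 : (Rnorm lo hi L omth Y (uA \- udag)%R <= D%:E)%E.
  rewrite zE; apply: (le_trans (hA2block z Hz)).
  rewrite /D [leRHS]EFinM; apply: lee_wpmul2l.
    by rewrite lee_fin mulr_ge0 ?sqrtr_ge0// ltW.
  rewrite sum_feature_error_sqr -poweR2V_EFin; last first.
    by apply: sumr_ge0 => S _; exact: sqr_ge0.
  apply: gt0_ler_poweR; rewrite ?invr_ge0//.
  - by rewrite in_itv/= leey andbT sume_ge0// => S _; rewrite mule_ge0 ?Hnorm_ge0.
  - by rewrite in_itv/= leey andbT lee_fin sumr_ge0// => S _; exact: sqr_ge0.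
  rewrite -sumEFin (bigD1 finset.set0)//= z0 Hnorm_cst0 mule0 add0e.
  apply: lee_sum => S /andP[SA S0].
  by rewrite EFinM lee_pmul ?Hnorm_ge0//; exact: block_err.
have [H2 tr2] := Rnorm_lty homth (le_lt_trans R2 (ltry _)).
pose c := Csamp * chi + Creg * Num.sqrt lreg * Bcoef.
(* Nonnegativity of [Bcoef] comes from the coefficient bound on the good event. It is needed for the
   slack [Cell * c] at the end. *)
have c0 : 0 <= c.
  rewrite addr_ge0// !mulr_ge0 ?(ltW hCsamp) ?(ltW hCreg) ?sqrtr_ge0 ?addr_ge0 ?invr_ge0 ?sqrtr_ge0//.
  exact: le_trans (sqrtr_ge0 _) Bcoef_ge.
have Rdag : (Rnorm lo hi L omth Y (udag \- u)%R <= (taures * N + D)%:E)%E.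
  (* Subtraction from [cst 0] plays the part of negation, so that the triangle inequality for
     differences suffices. *)
  have -> : (udag \- u = (cst 0 \- (u \- uA)) \- (uA \- udag))%R.
    by apply: funext => x /=; ring.
  apply: (le_trans (RnormB hlohi homth hY _ _ rL)); rewrite EFinD.
  apply: (leeD _ R2).
  apply: (le_trans (RnormB hlohi homth hY _ _ rL)).
  rewrite (Rnorm_cst0 hlohi omth hY) add0e EFinM.
  exact: hA1res.
have {}R3 : (Rnorm lo hi L omth Y (uhat \- udag)%R <=
    (Cls * (taures * N + D + c))%:E)%E.
  apply: (le_trans R3); rewrite EFinM; apply: lee_wpmul2l; first by rewrite lee_fin ltW.
  by rewrite EFinD; exact: leeD Rdag (lexx _).
have [H3 tr3] := Rnorm_lty homth (le_lt_trans R3 (ltry _)).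
have L22 : (L2norm (box lo hi) (uA \- udag)%R <= (Cell * D)%:E)%E.
  apply: (le_trans (hA2ell _ H2 tr2)).
  by rewrite EFinM; apply: lee_wpmul2l => //; rewrite lee_fin ltW.
have L23 : (L2norm (box lo hi) (uhat \- udag)%R <=
    (Cell * (Cls * (taures * N + D + c)))%:E)%E.
  apply: (le_trans (hA2ell _ H3 tr3)).
  by rewrite EFinM; apply: lee_wpmul2l => //; rewrite lee_fin ltW.
have mbox := measurable_box lo hi.
have [m1 _ _] := in_H_L2norm H1.
have [m2 _ _] := in_H_L2norm H2.
have [m3 _ _] := in_H_L2norm H3.
have -> : (u \- uhat = (u \- uA) \- ((uhat \- udag) \- (uA \- udag)))%R.
  by apply: funext => x /=; ring.
apply: (le_trans (L2normB mbox m1 (measurable_realfun.measurable_funB m3 m2))).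
apply: (le_trans (leeD hA1sol (le_trans (L2normB mbox m3 m2) (leeD L23 L22)))).
rewrite -!EFinM -!EFinD lee_fin -/D -subr_ge0.
(* The sampling and regularization term [c] enters only through the fitted function, with factor
   [Cell * Cls]; the stated factor [Cell * (1 + Cls)] exceeds this by [Cell]. *)
rewrite (_ : _ - _ = Cell * c); first by rewrite mulr_ge0// ltW.
by rewrite /c; ring.
Qed.
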